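(* Each of the problems Feedback Vertex Set, Even Cycle Transversal, Odd Cycle Transversal and Triangle Deletion, parameterized by vertex cover size $K$, is $(\mathrm{AL},K^3)$-streamable by a deterministic algorithm: there is a deterministic one-pass streaming algorithm in the adjacency list (AL) model that solves the problem on input graphs having a vertex cover of size at most $K$, using $O(K^3)$ words of space.
   Context: All graphs are finite, simple and undirected; $n$ is the number of vertices of the input graph $G$, and the vertex set is known in advance. In each problem the input is a graph $G$ (presented as a stream) and a non-negative integer $k$, and the question is whether there is a set $X\subset V(G)$ of size at most $k$ such that $G\setminus X$ (the subgraph induced by $V(G)\setminus X$) contains: no cycle (Feedback Vertex Set); no cycle of even length (Even Cycle Transversal); no cycle of odd length (Odd Cycle Transversal); no triangle (Triangle Deletion). When a problem is parameterized by vertex cover size $K$, the algorithm is additionally given an integer $K$ with the promise that the minimum vertex cover of $G$ has size at most $K$, and $k\le K$. AL (adjacency list) model: the vertices are exposed one after another in an arbitrary order; when a vertex $v$ is exposed, all edges incident to $v$ are revealed one by one in an arbitrary order (so each edge appears twice in the stream, once per endpoint). A deterministic algorithm solves a problem in a streaming model if it gives the correct output on every input instance presented in that model. A word consists of $O(\log n)$ bits. *)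

(* Defs.v *)
From HB Require Import structures.
From mathcomp Require Import all_boot.

Set Implicit Arguments.
Unset Strict Implicit.
Unset Printing Implicit Defensive.

Record sgraph (T : finType) := SGraph {
  adj : rel T;
  adj_sym : symmetric adj;
  adj_irr : irreflexive adj }.

Section Graphs.
Variable T : finType.
Implicit Type G : sgraph T.

Section Delete.
Variables (G : sgraph T) (X : {set T}).

Definition delete_adj : rel {v : T | v \notin X} :=
  fun x y => adj G (val x) (val y).

Lemma delete_adj_sym : symmetric delete_adj.
Proof. by move=> x y; apply: adj_sym. Qed.

Lemma delete_adj_irr : irreflexive delete_adj.
Proof. by move=> x; apply: adj_irr. Qed.

Definition delete : sgraph {v : T | v \notin X} :=
  SGraph delete_adj_sym delete_adj_irr.
End Delete.

Definition vertex_cover G (S : {set T}) : Prop :=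
  forall x y, adj G x y -> (x \in S) || (y \in S).

Definition is_cycle G (c : seq T) : bool :=
  (2 < size c) && ucycleb (adj G) c.

Definition acyclic G : Prop := forall c, ~ is_cycle G c.

Definition even_cycle_free G : Prop :=
  forall c, is_cycle G c -> odd (size c).

Definition odd_cycle_free G : Prop :=
  forall c, is_cycle G c -> ~~ odd (size c).

Definition triangle_free G : Prop :=
  forall x y z, adj G x y -> adj G y z -> adj G z x -> False.

End Graphs.

Definition graph_class := forall T : finType, sgraph T -> Prop.
Definition graph_problem := forall T : finType, sgraph T -> nat -> Prop.

Definition deletion_problem (P : graph_class) : graph_problem :=
  fun T G k => exists X : {set T}, #|X| <= k /\ P _ (delete G X).

Definition FeedbackVertexSet := deletion_problem acyclic.
Definition EvenCycleTransversal := deletion_problem even_cycle_free.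
Definition OddCycleTransversal := deletion_problem odd_cycle_free.
Definition TriangleDeletion := deletion_problem triangle_free.

(* [Edge u] reveals the edge between [u] and the last exposed vertex. *)
Inductive token := Expose of nat | Edge of nat.

Definition AL_stream n (G : sgraph 'I_n) (ts : seq token) : Prop :=
  exists (vs : seq 'I_n) (nb : 'I_n -> seq 'I_n),
    [/\ perm_eq vs (enum 'I_n),
        forall v, perm_eq (nb v) (enum [pred u | adj G v u])
      & ts = flatten [seq Expose (val v) :: [seq Edge (val u) | u <- nb v]
                     | v <- vs]].

(* Streaming algorithms are while-programs for a word RAM. The memory is one
   indirectly addressable array of words, initially all 0; the numbers n, k
   and K are read-only, and the stream is consumed from left to right. *)
Inductive binop := OpAdd | OpSub | OpMul | OpDiv | OpMod | OpEq | OpLt.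

Inductive expr :=
  | Const of nat
  | InN | InSol | InVC (* n, k and K *)
  | Fetch of expr
  | Bin of binop & expr & expr.

(* [Read e cv ce cend] takes the next token off the stream, stores its vertex
   at address [e] and runs [cv] or [ce] according to the kind of token; it
   runs [cend] if the stream is exhausted. *)
Inductive cmd :=
  | Skip
  | Store of expr & expr
  | Seq of cmd & cmd
  | If of expr & cmd & cmd
  | While of expr & cmd
  | Read of expr & cmd & cmd & cmd.

Record algorithm := Algorithm { body : cmd; answer : expr }.

Definition eval_binop (o : binop) (x y : nat) : nat :=
  match o with
  | OpAdd => x + y
  | OpSub => x - y
  | OpMul => x * y
  | OpDiv => x %/ y
  | OpMod => x %% y
  | OpEq => x == y
  | OpLt => x < y
  end.

Section Semantics.

(* [space] is the number of available words and [word] the number of values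
   of a word. A store outside these limits has no transition, so a program
   that has an execution never exceeds them. *)
Variables (n k K space word : nat).

Fixpoint eval (m : seq nat) (e : expr) : nat :=
  match e with
  | Const c => c
  | InN => n
  | InSol => k
  | InVC => K
  | Fetch a => nth 0 m (eval m a)
  | Bin o e1 e2 => eval_binop o (eval m e1) (eval m e2)
  end.

Definition fits (m : seq nat) (a : expr) (x : nat) : bool :=
  (eval m a < space) && (x < word).

Definition write (m : seq nat) (a : expr) (x : nat) : seq nat :=
  set_nth 0 m (eval m a) x.

Inductive exec :
  cmd -> seq nat -> seq token -> seq nat -> seq token -> Prop :=
  | exec_skip m ts : exec Skip m ts m ts
  | exec_store a e m ts :
      fits m a (eval m e) ->
      exec (Store a e) m ts (write m a (eval m e)) ts
  | exec_seq c1 c2 m ts m1 ts1 m2 ts2 :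
      exec c1 m ts m1 ts1 -> exec c2 m1 ts1 m2 ts2 ->
      exec (Seq c1 c2) m ts m2 ts2
  | exec_if e c1 c2 m ts m1 ts1 :
      exec (if eval m e != 0 then c1 else c2) m ts m1 ts1 ->
      exec (If e c1 c2) m ts m1 ts1
  | exec_while_stop e c m ts :
      eval m e = 0 -> exec (While e c) m ts m ts
  | exec_while_step e c m ts m1 ts1 m2 ts2 :
      eval m e != 0 -> exec c m ts m1 ts1 ->
      exec (While e c) m1 ts1 m2 ts2 ->
      exec (While e c) m ts m2 ts2
  | exec_read_expose a cv ce cend m v ts m1 ts1 :
      fits m a v -> exec cv (write m a v) ts m1 ts1 ->
      exec (Read a cv ce cend) m (Expose v :: ts) m1 ts1
  | exec_read_edge a cv ce cend m u ts m1 ts1 :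
      fits m a u -> exec ce (write m a u) ts m1 ts1 ->
      exec (Read a cv ce cend) m (Edge u :: ts) m1 ts1
  | exec_read_end a cv ce cend m m1 ts1 :
      exec cend m [::] m1 ts1 ->
      exec (Read a cv ce cend) m [::] m1 ts1.

Lemma exec_det c m ts m1 ts1 m2 ts2 :
  exec c m ts m1 ts1 -> exec c m ts m2 ts2 -> m1 = m2 /\ ts1 = ts2.
Proof.
move=> H1; elim: H1 m2 ts2 => {c m ts m1 ts1}.
- by move=> m ts m2 ts2 H2; inversion H2.
- by move=> a e m ts _ m2 ts2 H2; inversion H2.
- move=> c1 c2 m ts ma tsa mb tsb _ IH1 _ IH2 m2 ts2 H2; inversion H2; subst.
  by case: (IH1 _ _ ltac:(eassumption)) => ? ?; subst; apply: IH2.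
- by move=> e c1 c2 m ts ma tsa _ IH m2 ts2 H2; inversion H2; subst; apply: IH.
- move=> e c m ts e0 m2 ts2 H2; inversion H2; subst; first by [].
  match goal with H : is_true (eval ?m ?e != 0), H' : eval ?m ?e = 0 |- _ =>
      by rewrite H' in H end.
- move=> e c m ts ma tsa mb tsb e1 _ IH1 _ IH2 m2 ts2 H2.
  inversion H2; subst; first
    match goal with H : is_true (eval ?m ?e != 0), H' : eval ?m ?e = 0 |- _ =>
      by rewrite H' in H end.
  by case: (IH1 _ _ ltac:(eassumption)) => ? ?; subst; apply: IH2.
- by move=> a cv ce cend m v ts ma tsa _ _ IH m2 ts2 H2; inversion H2; subst;
    apply: IH.
- by move=> a cv ce cend m v ts ma tsa _ _ IH m2 ts2 H2; inversion H2; subst;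
    apply: IH.
- by move=> a cv ce cend m ma tsa _ IH m2 ts2 H2; inversion H2; subst;
    apply: IH.
Qed.

Lemma exec_space c m ts m1 ts1 :
  exec c m ts m1 ts1 -> size m <= space -> size m1 <= space.
Proof.
have wr m' a x : fits m' a x -> size m' <= space -> size (write m' a x) <= space.
  by case/andP=> lt_a _ le_m; rewrite size_set_nth geq_max lt_a.
by elim=> {c m ts m1 ts1} //; eauto.
Qed.

End Semantics.

Definition solves_with_vertex_cover_parameter
    (Pi : graph_problem) (A : algorithm) (C : nat) (f : nat -> nat) : Prop :=
  forall (n k K : nat) (G : sgraph 'I_n) (ts : seq token),
    k <= K ->
    (exists S : {set 'I_n}, vertex_cover G S /\ #|S| <= K) ->
    AL_stream G ts ->
    exists (m : seq nat) (ts' : seq token),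
      exec n k K (C * f K) (2 ^ (C * up_log 2 n)) (body A) [::] ts m ts' /\
      (eval n k K m (answer A) != 0 <-> Pi _ G k).

(* The constant [C] bounds both the number of words and the number of bits
   per word, the latter relative to the rounded-up binary logarithm of n. *)
Definition AL_streamable (Pi : graph_problem) (f : nat -> nat) : Prop :=
  exists (A : algorithm) (C : nat), solves_with_vertex_cover_parameter Pi A C f.

(* Main.v *)
Require Import Defs.
From mathcomp Require Import all_boot.
From mathcomp Require Import zify.
From Stdlib Require Import FunctionalExtensionality.

(** Put c = min(n, K), so that G has a vertex cover S of size at most c. While
    reading the stream, keep a greedy matching with vertex set M; every matching
    edge has an endpoint in S, so |M| <= 2c. If a vertex y is still unmatched
    when its edges have all been read, then N(y) is contained in M, for otherwise
    y would have been matched; hence y is never matched later. When y is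
    finished, record its edges to M if y is in M, and for each pair (a, b) of
    neighbours of y in M record the path a-y-b unless 3c + 1 paths are already
    recorded for (a, b). This takes O(c^3) words.

    Let H be the recorded graph and X a set of at most k vertices. Cycles of G
    have length at most 2c, so if a vertex y outside M of a cycle avoiding X has an
    unrecorded path a-y-b on the cycle, then one of the 3c + 1 paths recorded for
    (a, b) has a middle vertex that is neither in X nor on the cycle. Replacing
    such y one by one turns the cycle into a cycle of H of the same length.
    Hence X hits all cycles of prescribed lengths in G iff it does so in H, and
    for H this is decided by enumerating all X and all vertex sequences of length
    at most 2c, using counters in base n + 1. *)

Set Implicit Arguments.
Unset Strict Implicit.
Unset Printing Implicit Defensive.

(** * Memory layout and program logic *)

(* Memory holds one array per register, interleaved so that entry [i] of [r]
   is at address [code r + 32 * i]; scalars use entry 0. [Cur], [Mat], [EndA],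
   [EndB] and [Mid] hold a vertex plus one, 0 standing for none; [VecX] and
   [VecC] hold the vertices themselves, with n as padding. *)
Inductive reg :=
  | Rej | Tok | Cur | InM | NumM | Idx | Found | Done
  | Mat | Nbr | Cnt | EndA | EndB | Mid
  | VecX | VecC | Carry | Digit | Stop | Len | Pos | Aux
  | TAdj | TDel | TDup | TBad | TCyc | TLen | TSol.

Definition code (r : reg) : nat :=
  match r with
  | Rej => 0 | Tok => 1 | Cur => 2 | InM => 3 | NumM => 4 | Idx => 5
  | Found => 6 | Done => 7 | Mat => 8 | Nbr => 9 | Cnt => 10 | EndA => 11
  | EndB => 12 | Mid => 13 | VecX => 14 | VecC => 15 | Carry => 16
  | Digit => 17 | Stop => 18 | Len => 19 | Pos => 20 | Aux => 21
  | TAdj => 22 | TDel => 23 | TDup => 24 | TBad => 25 | TCyc => 26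
  | TLen => 27 | TSol => 28
  end.

Lemma code_lt r : code r < 32. Proof. by case: r. Qed.

Definition state := reg -> nat -> nat.

Definition view (m : seq nat) : state := fun r i => nth 0 m (code r + 32 * i).

Definition upd (s : state) r i x : state :=
  fun r' i' => if (code r' == code r) && (i' == i) then x else s r' i'.

(** Frame condition: at most the registers in [rs] have changed. Comparing values of [code] gives a
    boolean test on registers. *)
Definition same (rs : seq reg) (s s' : state) : Prop :=
  forall r i, ~~ has (fun r' => code r == code r') rs -> s' r i = s r i.

Inductive xp :=
  | XC of nat | XN | XSol | XVC
  | XA of reg & xp
  | XB of binop & xp & xp.

Definition addr r e := Bin OpAdd (Const (code r)) (Bin OpMul (Const 32) e).

Fixpoint cp (e : xp) : expr :=
  match e with
  | XC c => Const c
  | XN => InN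
  | XSol => InSol
  | XVC => InVC
  | XA r e => Fetch (addr r (cp e))
  | XB o e1 e2 => Bin o (cp e1) (cp e2)
  end.

Declare Scope xp_scope.
Delimit Scope xp_scope with X.
Bind Scope xp_scope with xp.
Notation "x + y" := (XB OpAdd x y) : xp_scope.
Notation "x - y" := (XB OpSub x y) : xp_scope.
Notation "x * y" := (XB OpMul x y) : xp_scope.
Notation "x %/ y" := (XB OpDiv x y) : xp_scope.
Notation "x %% y" := (XB OpMod x y) : xp_scope.
Notation "x =? y" := (XB OpEq x y) (at level 70) : xp_scope.
Notation "x <? y" := (XB OpLt x y) (at level 70) : xp_scope.
Notation "c1 ;; c2" := (Seq c1 c2) (at level 90, right associativity).
Notation "'#' c" := (XC c) (at level 1, format "# c") : xp_scope.
Notation "'!' r" := (XA r (XC 0)) (at level 1, format "! r") : xp_scope.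
Notation "r .[ e ]" := (XA r e) : xp_scope.

Definition Put r e x := Store (addr r (cp e)) (cp x).
Definition SetR r x := Put r #0 x.
Definition IfX e c1 c2 := If (cp e) c1 c2.
Definition Get r cv ce cend := Read (addr r (Const 0)) cv ce cend.
Definition Loop v hi c :=
  While (cp (!v <? hi)) (c ;; SetR v (!v + #1)).
Definition For v hi c := SetR v #0 ;; Loop v hi c.

Lemma same_trans rs s2 s1 s3 : same rs s1 s2 -> same rs s2 s3 -> same rs s1 s3.
Proof. by move=> h1 h2 r i hr; rewrite h2 // h1. Qed.

Lemma same_upd rs s s' r i x :
  has (fun r' => code r == code r') rs -> same rs s s' -> same rs s (upd s' r i x).
Proof.
move=> hr h r' i' hr'; rewrite /upd; case: eqP => [e|_] /=; last exact: h.
by rewrite e hr in hr'.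
Qed.

Lemma same_sub rs1 rs2 s s' :
  (forall r, has (fun r' => code r == code r') rs1 ->
     has (fun r' => code r == code r') rs2) ->
  same rs1 s s' -> same rs2 s s'.
Proof. by move=> h hs r i hr; apply: hs; apply: contra hr; apply: h. Qed.

Lemma updE s r i x r' j :
  upd s r i x r' j = if (code r' == code r) && (j == i) then x else s r' j.
Proof. by []. Qed.

Lemma upd_same s r i x : upd s r i x r i = x.
Proof. by rewrite /upd !eqxx. Qed.

Lemma upd_id s r i : upd s r i (s r i) = s.
Proof.
apply: functional_extensionality => r'; apply: functional_extensionality => j.
rewrite /upd; case: andP => // -[/eqP e /eqP ->].
by have -> : r' = r by move: e; case: r'; case: r.
Qed.

(** * Total-correctness rules for the compiled programs *)

Section Rules.
Variables (n k K space word ix : nat).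
Hypothesis ix_space : 32 * ix <= space.

Fixpoint ev (s : state) (e : xp) : nat :=
  match e with
  | XC c => c
  | XN => n
  | XSol => k
  | XVC => K
  | XA r e => s r (ev s e)
  | XB o e1 e2 => eval_binop o (ev s e1) (ev s e2)
  end.

Lemma eval_cp m e : eval n k K m (cp e) = ev (view m) e.
Proof. by elim: e => //= [r e ->|o e1 -> e2 ->]. Qed.

(** Codes are below 32, so [code r + 32 * i] determines both [r] and [i], and a write changes a
    single cell of the view. *)
Lemma view_write m a r i x :
  eval n k K m a = code r + 32 * i ->
  view (write n k K m a x) = upd (view m) r i x.
Proof.
move=> ea; apply: functional_extensionality => r'.
apply: functional_extensionality => i'.
rewrite /view /upd /write nth_set_nth /= ea.
have := code_lt r; have := code_lt r' => h' h.
have -> : (code r' + 32 * i' == code r + 32 * i) = (code r' == code r) && (i' == i).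
  by apply/idP/idP => [/eqP|/andP[/eqP -> /eqP ->] //]; lia.
by case: ifP.
Qed.

(** Total correctness: an execution exists, so the program halts and stays within [space] and
    [word]. A state is only the view of a memory, hence the quantifier over all [m] with that
    view. *)
Definition wp c (Q : state -> seq token -> Prop) (s : state) (ts : seq token) :=
  forall m, view m = s -> exists m' ts',
    exec n k K space word c m ts m' ts' /\ Q (view m') ts'.

Lemma wp_conseq c (Q Q' : state -> seq token -> Prop) s ts :
  (forall s' ts', Q s' ts' -> Q' s' ts') -> wp c Q s ts -> wp c Q' s ts.
Proof. by move=> h w m /w [m' [ts' [e q]]]; exists m', ts'; split; auto. Qed.

Lemma wp_then c (Q Q' : state -> seq token -> Prop) s ts :
  wp c Q s ts -> (forall s' ts', Q s' ts' -> Q' s' ts') -> wp c Q' s ts.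
Proof. by move=> w h; apply: wp_conseq w. Qed.

Lemma wp_skip (Q : state -> seq token -> Prop) s ts : Q s ts -> wp Skip Q s ts.
Proof. by move=> q m e; exists m, ts; rewrite e; split=> //; constructor. Qed.

Lemma wp_put r e x (Q : state -> seq token -> Prop) s ts :
  ev s e < ix -> ev s x < word -> Q (upd s r (ev s e) (ev s x)) ts ->
  wp (Put r e x) Q s ts.
Proof.
move=> le lx q m em.
exists (write n k K m (addr r (cp e)) (eval n k K m (cp x))), ts; split.
  constructor; rewrite /fits /= !eval_cp em lx andbT.
  by have := code_lt r; lia.
by rewrite (view_write (r := r) (i := ev s e)) /= ?eval_cp ?em.
Qed.

Lemma wp_seq c1 c2 Q s ts : wp c1 (wp c2 Q) s ts -> wp (Seq c1 c2) Q s ts.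
Proof.
move=> w m /w [m1 [ts1 [e1 w1]]]; have [m2 [ts2 [e2 q]]] := w1 _ erefl.
by exists m2, ts2; split=> //; apply: exec_seq e1 e2.
Qed.

Lemma wp_if e c1 c2 Q s ts :
  (ev s e != 0 -> wp c1 Q s ts) -> (ev s e = 0 -> wp c2 Q s ts) ->
  wp (IfX e c1 c2) Q s ts.
Proof.
move=> w1 w2 m em.
have [m' [ts' [h q]]] : exists m' ts',
    exec n k K space word (if eval n k K m (cp e) != 0 then c1 else c2) m ts m' ts'
    /\ Q (view m') ts'.
  rewrite eval_cp em; case: eqP => [e0|/eqP e1] /=; [exact: w2|exact: w1].
by exists m', ts'; split=> //; constructor.
Qed.

Lemma wp_while e c Q s ts :
  (ev s e = 0 -> Q s ts) -> (ev s e != 0 -> wp c (wp (While (cp e) c) Q) s ts) ->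
  wp (While (cp e) c) Q s ts.
Proof.
move=> w0 w1 m em; case: (eqVneq (ev s e) 0) => he.
  by exists m, ts; rewrite em; split; [apply: exec_while_stop; rewrite eval_cp em|auto].
have [m1 [ts1 [e1 h1]]] := w1 he _ em; have [m2 [ts2 [e2 q]]] := h1 _ erefl.
exists m2, ts2; split=> //; apply: exec_while_step e1 e2.
by rewrite eval_cp em.
Qed.

Lemma wp_get_expose r cv ce cend Q s v ts :
  0 < ix -> v < word -> wp cv Q (upd s r 0 v) ts ->
  wp (Get r cv ce cend) Q s (Expose v :: ts).
Proof.
move=> i0 lv w m em.
have [|m' [ts' [h q]]] := w (write n k K m (addr r (Const 0)) v).
  by rewrite (view_write (r := r) (i := 0)) ?em.
exists m', ts'; split=> //; constructor=> //.
by rewrite /fits /= lv andbT; have := code_lt r; lia.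
Qed.

Lemma wp_get_edge r cv ce cend Q s v ts :
  0 < ix -> v < word -> wp ce Q (upd s r 0 v) ts ->
  wp (Get r cv ce cend) Q s (Edge v :: ts).
Proof.
move=> i0 lv w m em.
have [|m' [ts' [h q]]] := w (write n k K m (addr r (Const 0)) v).
  by rewrite (view_write (r := r) (i := 0)) ?em.
exists m', ts'; split=> //; constructor=> //.
by rewrite /fits /= lv andbT; have := code_lt r; lia.
Qed.

Lemma wp_get_end r cv ce cend Q s :
  wp cend Q s [::] -> wp (Get r cv ce cend) Q s [::].
Proof.
move=> w m /w [m' [ts' [h q]]].
by exists m', ts'; split=> //; constructor.
Qed.

(** [I i] describes the state once the counter has been set to [i], so the postcondition of the body
    speaks of the state after the increment. The final value [N] is stored too, whence
    [N < word]. *)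
Lemma wp_for (I : nat -> state -> Prop) N v hi c Q s ts :
  0 < ix -> N < word ->
  I 0 (upd s v 0 0) ->
  (forall i s, I i s -> ev s hi = N) ->
  (forall i s, i < N -> I i s -> s v 0 = i ->
     wp c (fun s' ts' => [/\ ts' = ts, s' v 0 = i & I i.+1 (upd s' v 0 i.+1)]) s ts) ->
  (forall s, I N s -> s v 0 = N -> Q s ts) ->
  wp (For v hi c) Q s ts.
Proof.
move=> i0 Nw I0 hN step fin; apply: wp_seq; apply: wp_put => //=; first lia.
suff main d i s' : I i s' -> s' v 0 = i -> N = d + i -> wp (Loop v hi c) Q s' ts.
  by apply: (main N _ _ I0); rewrite ?upd_same ?addn0.
clear I0; elim: d i s' => [|d IH] i {}s Ii vi eN; apply: wp_while => /=;
  rewrite (hN _ _ Ii) vi.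
- by move=> _; apply: fin; rewrite eN.
- by rewrite eN ltnn.
- by rewrite eN addSn ltnS leq_addl.
- move=> _; apply: wp_seq; apply: wp_conseq (step i s _ Ii vi); last by lia.
  move=> s' _ [-> vi' Ii']; apply: wp_put => /=; [lia | rewrite vi'; lia|].
  rewrite vi' addn1; apply: IH => //; first by rewrite upd_same.
  by rewrite upd_same eN addSnnS.
Qed.

End Rules.

(** * Rerouting cycles into a sparse subgraph *)

(** Common form of the four target classes, which differ only in the set [Lp] of forbidden cycle
    lengths. *)
Definition no_cycle (Lp : pred nat) : graph_class :=
  fun T G => forall c : seq T, is_cycle G c -> ~~ Lp (size c).

Section Cycles.
Variables (T : finType).
Implicit Types (G : sgraph T) (c : seq T).

Definition hits (e : rel T) (Lp : pred nat) (X : pred T) : Prop :=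
  forall c, 2 < size c -> cycle e c -> uniq c -> Lp (size c) -> has X c.

(** Cycles of [delete G X] correspond under [val] to the cycles of [G] that avoid [X]. *)
Lemma deletion_no_cycle (Lp : pred nat) G (X : {set T}) :
  no_cycle Lp (delete G X) <-> hits (adj G) Lp (mem X).
Proof.
split=> h.
  move=> c sc cc uc lc; apply: contraT => /hasPn cX.
  have [c' ec] : exists c' : seq {v : T | v \notin X}, c = map val c'.
    elim: c cX {sc cc uc lc} => [|x c IH] cX; first by exists [::].
    have [|c' ->] := IH; first by move=> y hy; apply: cX; rewrite inE hy orbT.
    have xX : x \notin X by apply: cX; rewrite inE eqxx.
    by exists (exist _ x xX :: c').
  have := h c'; rewrite /is_cycle /ucycleb; subst c.
  rewrite size_map in sc lc; rewrite sc lc.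
  rewrite (map_inj_uniq val_inj) in uc; rewrite uc andbT.
  move=> /(_ _) /= -> //.
  case: c' cc {sc cX uc lc} => //= x c'; rewrite -map_rcons.
  by rewrite path_map.
move=> c /andP[sc /andP[cc uc]]; apply/negP => lc.
have := h (map val c); rewrite size_map (map_inj_uniq val_inj) => /(_ sc).
rewrite uc lc; have -> : cycle (adj G) (map val c).
  by case: c cc {sc uc lc} => //= x c; rewrite -map_rcons path_map.
move=> /(_ isT isT isT) /hasP[x /mapP[y _ ->]] /=.
by rewrite (negbTE (valP y)).
Qed.

(** Each of the [size c] edges of the cycle has an end in [S], and each vertex of the cycle lies on
    two of these edges. *)
Lemma cycle_size_cover G (S : {set T}) c :
  vertex_cover G S -> cycle (adj G) c -> uniq c -> size c <= 2 * #|S|.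
Proof.
move=> VC cc uc.
have hp x p : path (adj G) x p ->
    size p <= count (mem S) (belast x p) + count (mem S) p.
  elim: p x => //= y p IH x /andP[/VC xy /IH]; lia.
have cS : count (mem S) c <= #|S|.
  rewrite -size_filter cardE; apply: uniq_leq_size; first exact: filter_uniq.
  by move=> x; rewrite mem_filter mem_enum => /andP[].
case: c cc uc cS => //= x c /hp; rewrite size_rcons belast_rcons /= -cats1 count_cat /=.
lia.
Qed.

(* A cycle of [adj G] is rerouted into [e'] one vertex outside [M] at a time;
   each step makes the two edges at the new vertex edges of [e'] and leaves
   the other edges alone, so the number of edges outside [e'] drops. *)
Lemma reroute G (e' : rel T) (M X : pred T) l c :
  symmetric e' ->
  (forall u v, e' u v -> adj G u v) ->
  (forall u v, M u -> M v -> adj G u v -> e' u v) ->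
  (forall y x, ~~ M y -> adj G y x -> M x) ->
  (forall y a b, ~~ M y -> adj G y a -> adj G y b ->
     (e' a y /\ e' b y) \/
     exists ys, [/\ uniq ys, l <= size ys & {in ys, forall z, e' a z /\ e' b z}]) ->
  #|X| + size c < l -> 2 < size c ->
  cycle (adj G) c -> uniq c -> ~~ has X c ->
  exists c', [/\ size c' = size c, cycle e' c', uniq c' & ~~ has X c'].
Proof.
move=> sym' sub MM IM ex.
(* Number of cyclically consecutive pairs of [c] that are not edges of [e']; the induction decreases
   it. *)
pose bad c := count (fun uv => ~~ e' uv.1 uv.2) (zip c (rot 1 c)).
have good c1 : bad c1 = 0 -> cycle e' c1.
  rewrite /bad; case: c1 => //= x p; rewrite rot1_cons.
  move: {2 4}x => z; elim: p x => [|y p IH] x /=; first by case: (e' _ _).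
  by case: (e' x y) => //= h; apply: IH.
have badrot c1 i : bad (rot i c1) = bad c1.
  rewrite /bad rot_rot; apply/permP.
  rewrite (_ : zip _ _ = rot i (zip c1 (rot 1 c1))); last first.
    have e2 := size_rot 1 c1.
    rewrite -[RHS]zip_unzip /unzip1 /unzip2 !map_rot -/unzip1 -/unzip2.
    by rewrite unzip1_zip ?unzip2_zip ?e2.
  by rewrite perm_rot.
move: {2}(bad c).+1 (ltnSn (bad c)) => d.
elim: d c => // d IH c bd sz s3 cc uc Xc.
case: (posnP (bad c)) => [/good cc'|b1]; first by exists c.
pose ok c1 := [/\ size c1 = size c, bad c1 = bad c, cycle (adj G) c1, uniq c1 & ~~ has X c1].
have okrot c1 i : ok c1 -> ok (rot i c1).
  by move=> [? ? ? ? ?]; split; rewrite ?size_rot ?badrot ?rot_cycle ?rot_uniq ?has_rot.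
(* Rotate a missing edge to the front. By [MM] one of its ends lies outside [M]; that end becomes
   [y], with neighbours [a] and [b] on the cycle. *)
have [y [a [p [b [okc My ne]]]]] : exists y a p b,
    [/\ ok (y :: a :: rcons p b), ~~ M y & ~~ (e' y a && e' b y)].
  have key y q : ok (y :: q) -> ~~ M y -> ~~ e' y (head y q) \/ ~~ e' (last y q) y ->
     exists y a p b, [/\ ok (y :: a :: rcons p b), ~~ M y & ~~ (e' y a && e' b y)].
    case: q => [|a q] okq My; first by case: okq => e1; move: s3; rewrite -e1.
    case/lastP: q okq => [|p b] okq; first by case: okq => e1; move: s3; rewrite -e1.
    rewrite /= last_rcons => h; exists y, a, p, b; split=> //.
    by rewrite negb_and; apply/orP.
  move: b1; rewrite -has_count => /hasP[[u v]] /= uvin nuv.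
  have [q okq] : exists q, ok [:: u, v & q].
    have [j jl /= ej] := (nthP (u, v) uvin).
    have okj : ok (rot j c) by apply: okrot; split.
    move: jl ej okj; rewrite size_zip size_rot minnn => jl.
    rewrite nth_zip ?size_rot // => -[eu evv]; have {}jl : j < @size T c := jl.
    have := drop_nth u jl; rewrite eu /rot => ->.
    move: evv; rewrite /rot nth_cat size_drop.
    case: ltnP => [jl1|jl1].
      rewrite nth_drop add1n => evv.
      have jl2 : j.+1 < size c by lia.
      rewrite (drop_nth v jl2) evv.
      by move=> okj; eexists; exact: okj.
    have j0 : 0 < j by apply: leq_trans jl1; rewrite subn_gt0 ltnW.
    have -> : j - (size c - 1) = 0 by lia.
    rewrite nth_take // drop_oversize; last by change (@size T c <= j.+1); lia.
    rewrite -[take j c]drop0 (drop_nth v) ?size_takel ?nth_take // ?(ltnW jl) //.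
    by move=> -> okj; eexists; exact: okj.
  have [_ _ /= /andP[auv _] _ _] := okq.
  case Mu: (M u); last by apply: (key u (v :: q) okq); [rewrite Mu | left].
  have Mv : ~~ M v by apply: contra nuv => Mv; apply: MM.
  apply: (key v (rcons q u) _ Mv); last by right; rewrite last_rcons.
  by have := okrot _ 1 okq; rewrite rot1_cons.
case: okc => sz' bad' cc' uc' Xc'.
have aya : adj G y a by case/andP: cc'.
have ayb : adj G y b.
  move: cc'; rewrite /= rcons_path last_rcons => /and3P[_ _].
  by rewrite adj_sym.
have [[ea eb]|[ys [uys lys hys]]] := ex _ _ _ My aya ayb.
  by rewrite sym' ea eb in ne.
(* Isolates the two edges at the first vertex, the only ones that change when [y] is replaced. *)
have badE w : bad [:: w, a & rcons p b] =
    ~~ e' w a + (count (fun uv => ~~ e' uv.1 uv.2) (zip (a :: p) (rcons p b)) + ~~ e' b w).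
  by rewrite /bad rot1_cons /= -rcons_cons zip_rcons /= ?size_rcons // -cats1 count_cat /= addn0.
(* [ys] has at least [l] elements, more than [X] and the rest of the cycle have together. *)
have [z zin /norP[zX zc]] : exists2 z, z \in ys & ~~ (X z || (z \in a :: rcons p b)).
  apply/hasP; apply: contraT; rewrite -all_predC => /allP nz.
  have: size ys <= size (enum X ++ (a :: rcons p b)).
    apply: uniq_leq_size => // w /nz /=; rewrite negbK mem_cat mem_enum.
    by move=> h; exact: h.
  rewrite size_cat -cardE => /(leq_trans lys); rewrite leqNgt => /negP[].
  by apply: leq_ltn_trans sz; rewrite leq_add2l -sz' leqnSn.
have [eaz ebz] := hys z zin.
have ezz : e' z a by rewrite sym'.
have [||||||c' [sc' ? ? ?]] := IH [:: z, a & rcons p b].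
- move: bd; rewrite -bad' !badE ezz ebz addn0 add0n.
  move: ne; case: (e' y a); case: (e' b y) => //= _; rewrite ?addn0 ?addn1 ?add1n.
  + by [].
  + by [].
  + by rewrite ltnS; apply: leq_trans.
- by move: sz; rewrite -sz'.
- by move: s3; rewrite -sz'.
- move: cc'; rewrite /= !rcons_path !last_rcons => /and3P[_ -> _] /=.
  by rewrite !sub.
- by move: uc'; rewrite [uniq (y :: _)]cons_uniq [uniq (z :: _)]cons_uniq zc => /andP[].
- by move: Xc'; rewrite /= (negbTE zX) => /norP[].
by exists c'; split=> //; rewrite sc' -sz'.
Qed.

(** Edges of [e'] are edges of [G], which gives one direction. Conversely a cycle of [G] avoiding
    [X] is rerouted to one of the same length in [e']; [2 * #|S|] bounds that length. *)
Lemma hits_reroute G (e' : rel T) (M : pred T) (Lp : pred nat) (S X : {set T}) l :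
  symmetric e' ->
  (forall u v, e' u v -> adj G u v) ->
  (forall u v, M u -> M v -> adj G u v -> e' u v) ->
  (forall y x, ~~ M y -> adj G y x -> M x) ->
  (forall y a b, ~~ M y -> adj G y a -> adj G y b ->
     (e' a y /\ e' b y) \/
     exists ys, [/\ uniq ys, l <= size ys & {in ys, forall z, e' a z /\ e' b z}]) ->
  vertex_cover G S -> #|X| + 2 * #|S| < l ->
  hits e' Lp (mem X) <-> hits (adj G) Lp (mem X).
Proof.
move=> sym' sub MM IM ex VC lt; split=> h c sc cc uc lc; last first.
  apply: h => //; case: c cc {sc uc lc} => //= x c.
  by apply: sub_path => u v; apply: sub.
apply: contraT => Xc.
have [|c' [sc' cc' uc' Xc']] := reroute sym' sub MM IM ex _ sc cc uc Xc.
  apply: leq_ltn_trans lt; apply: leq_add; last exact: cycle_size_cover VC cc uc.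
  exact/eq_leq/eq_card.
by move: Xc'; rewrite h // sc'.
Qed.
End Cycles.

(** * The target classes as forbidden cycle lengths *)

Section Problems.
Variables (T : finType) (G : sgraph T).

Lemma acyclic_no_cycle : acyclic G <-> no_cycle predT G.
Proof.
by split=> h c; [move=> /h | apply/negP; apply/negP => /h].
Qed.

Lemma triangle_no_cycle : triangle_free G <-> no_cycle (pred1 3) G.
Proof.
split=> h.
  move=> c /andP[_ /andP[cc uc]]; apply/negP => /= /eqP.
  case: c cc {uc} => [|x [|y [|z []]]] //= /and4P[xy yz zx _] _.
  exact: h xy yz zx.
move=> x y z xy yz zx; have := h [:: x; y; z].
rewrite /is_cycle /ucycleb /= xy yz zx !inE !negb_or => /(_ _) /=.
have ne u v : adj G u v -> u != v by apply: contraTneq => ->; rewrite adj_irr.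
by rewrite ne // eq_sym (ne _ _ zx) (ne _ _ yz) => /(_ isT).
Qed.
End Problems.

Lemma deletion_problem_iff (P1 P2 : graph_class) (T : finType) (G : sgraph T) k :
  (forall T (G : sgraph T), P1 T G <-> P2 T G) ->
  deletion_problem P1 G k <-> deletion_problem P2 G k.
Proof. by move=> h; split=> -[X [kX /h hX]]; exists X. Qed.

(** * The streaming phase *)

(** With truncated subtraction this is the minimum of [n] and [e]. The word size depends on [n]
    alone, so loop bounds must be bounded in terms of [n]. *)
Definition xcap (e : xp) : xp := (XN - (XN - e))%X.
Definition xK : xp := xcap XVC.
Definition xk : xp := xcap XSol.
Definition xM : xp := (#2 * xK)%X.
Definition xl : xp := (#3 * xK + #1)%X.
Definition xMM : xp := (xM * xM)%X.
Definition xslot (t i : xp) : xp := (t * (xl + #1) + i)%X.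
Definition xJ : xp := (xMM * (xl + #1))%X.

(* Slot [j] records the path EndA[j] - Mid[j] - EndB[j]. For the pair
   [t = p * xM + q] of entries of [Mat], the slots [t * (xl + 1) + i] with
   [i < xl] record paths from Mat[p] to Mat[q]; the last one, with [i = xl],
   records the edge Mat[p] - Mat[q] as a path with equal ends. *)
Definition put_slot (j a b : xp) : cmd :=
  Put EndA j a ;; Put EndB j b ;; Put Mid j !Cur.

(** Products of truth values serve as conjunctions. The first test handles edges between the current
    vertex and another entry of [Mat], the second one paths through the current vertex. *)
Definition finish_vertex : cmd :=
  For Idx xMM (
    IfX (Nbr.[!Idx %/ xM] * (Mat.[!Idx %% xM] =? !Cur))
      (put_slot (xslot !Idx xl) Mat.[!Idx %/ xM] Mat.[!Idx %/ xM]) Skip ;;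
    IfX (Nbr.[!Idx %/ xM] * Nbr.[!Idx %% xM] * (Cnt.[!Idx] <? xl))
      (put_slot (xslot !Idx Cnt.[!Idx]) Mat.[!Idx %/ xM] Mat.[!Idx %% xM] ;;
       Put Cnt !Idx (Cnt.[!Idx] + #1)) Skip).

Definition start_vertex : cmd :=
  SetR Cur (!Tok + #1) ;; SetR InM #0 ;;
  For Idx xM (Put Nbr !Idx #0 ;; IfX (Mat.[!Idx] =? !Cur) (SetR InM #1) Skip).

(** Greedy step: an edge with both ends unmatched joins the matching. The [Nbr] flag of the new
    entry is set separately, as the scan ran before it entered [Mat]. *)
Definition read_edge : cmd :=
  SetR Found #0 ;;
  For Idx xM (IfX (Mat.[!Idx] =? !Tok + #1) (Put Nbr !Idx #1 ;; SetR Found #1) Skip) ;;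
  IfX !Found Skip (IfX !InM Skip (
    Put Mat !NumM (!Tok + #1) ;; Put Mat (!NumM + #1) !Cur ;; Put Nbr !NumM #1 ;;
    SetR NumM (!NumM + #2) ;; SetR InM #1)).

(** A neighbour list has no end marker, so a vertex is finished when the next one is exposed or the
    stream ends. [Cur] is 0 before the first vertex. *)
Definition read_stream : cmd :=
  While (cp (!Done =? #0)) (
    Get Tok (IfX !Cur finish_vertex Skip ;; start_vertex) read_edge
      (IfX !Cur finish_vertex Skip ;; SetR Done #1)).



Section Stream.
Variables (n k K space word ix : nat).

Definition cap x := n - (n - x).
Definition max_matched := 2 * cap K.
Definition pair_limit := 3 * cap K + 1.
Definition num_slots := max_matched * max_matched * (pair_limit + 1).
Notation M := max_matched.
Notation l := pair_limit.
Notation J := num_slots.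

Hypothesis ix_space : 32 * ix <= space.
Hypothesis K_gt0 : 0 < cap K.
Hypothesis J_ix : J < ix.
Hypothesis nJ_word : n + J + 2 < word.

Notation ev := (ev n k K).
Notation wp := (wp n k K space word).

Lemma fold_M : 2 * (n - (n - K)) = M. Proof. by []. Qed.
Lemma fold_l : 3 * (n - (n - K)) + 1 = l. Proof. by []. Qed.
Definition evE := (fold_M, fold_l).

Lemma M_gt0 : 0 < M. Proof. by move: K_gt0; clear; rewrite /max_matched; lia. Qed.
Lemma M_MM : M <= M * M. Proof. by rewrite leq_pmull // M_gt0. Qed.
Lemma MM_J : M * M <= J. Proof. by rewrite /num_slots leq_pmulr // addn1. Qed.

Lemma slot_lt t i : t < M * M -> i <= l -> t * (l + 1) + i < J.
Proof.
move=> tM il; apply: (@leq_trans (t.+1 * (l + 1))); first by rewrite mulSn addnC ltn_add2r addn1 ltnS.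
by rewrite /num_slots leq_mul2r tM orbT.
Qed.

Lemma slot_inj t i t' i' : i <= l -> i' <= l ->
  t * (l + 1) + i = t' * (l + 1) + i' -> t = t' /\ i = i'.
Proof.
move=> il il' e; have e1 : t = t'.
  have := congr1 (divn^~ (l + 1)) e.
  by rewrite !divnMDl ?divn_small ?addn0 //; lia.
by split=> //; move: e; rewrite e1; lia.
Qed.

Variables (G : sgraph 'I_n) (S : {set 'I_n}).
Hypothesis VC : vertex_cover G S.
Hypothesis SK : #|S| <= cap K.

Implicit Types (ms dn r ys : seq 'I_n) (s : state).

Definition enc (v : 'I_n) : nat := v.+1.
Definition mat ms p := nth 0 [seq enc v | v <- ms] p.

Lemma enc_inj : injective enc.
Proof. by move=> u v [] /val_inj. Qed.

Lemma enc_lt v : enc v <= n.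
Proof. exact: ltn_ord. Qed.

Lemma mat_lt ms p : mat ms p <= n.
Proof.
rewrite /mat; case: (ltnP p (size ms)) => h; last by rewrite nth_default ?size_map.
by have := mem_nth 0 (s := map enc ms) (n := p); rewrite size_map => /(_ h) /mapP[v _ ->]; exact: enc_lt.
Qed.

Lemma matP ms p v : mat ms p = enc v -> p < size ms /\ v \in ms.
Proof.
rewrite /mat; case: (ltnP p (size ms)) => h; last by rewrite nth_default ?size_map.
move=> e; split=> //; rewrite -(mem_map enc_inj) -e.
by apply: mem_nth; rewrite size_map.
Qed.

Lemma mat_index ms v : v \in ms -> mat ms (index v ms) = enc v.
Proof. by move=> vm; rewrite /mat (nth_map v) ?index_mem // nth_index. Qed.

Lemma mat_inj ms p v : uniq ms -> mat ms p = enc v -> p = index v ms.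
Proof.
move=> um e; have [pm vm] := matP e.
apply/eqP; rewrite -(nth_uniq 0 (s := map enc ms)) ?size_map ?index_mem //.
  by rewrite -/(mat ms p) -/(mat ms _) e mat_index.
by rewrite (map_inj_uniq enc_inj).
Qed.

Lemma mat_cat ms ms' p : p < size ms -> mat (ms ++ ms') p = mat ms p.
Proof. by move=> h; rewrite /mat map_cat nth_cat size_map h. Qed.

(** * Invariants of the streaming phase *)

Definition stored s j a b y := [/\ s EndA j = a, s EndB j = b & s Mid j = y].

(** Makes the recorded graph a subgraph of [G]; the value 0 of [Mid] marks an empty slot. *)
Definition sound s := forall j, s Mid j = 0 \/ exists a b y,
  [/\ stored s j (enc a) (enc b) (enc y), adj G a y & adj G b y].

Definition edge_slot ms s t :=
  stored s (t * (l + 1) + l) (mat ms (t %/ M)) (mat ms (t %/ M)) (mat ms (t %% M)).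

(** [ys] lists the recorded middle vertices of the pair in slot order. The last clause is the quota:
    while fewer than [l] are recorded, no finished common neighbour outside [ms] is missing. *)
Definition pair_slots dn ms s t := exists ys,
  [/\ [/\ uniq ys, size ys = s Cnt t & size ys <= l], {subset ys <= dn},
      forall i, i < size ys -> [/\ t %/ M < size ms, t %% M < size ms &
        stored s (t * (l + 1) + i) (mat ms (t %/ M)) (mat ms (t %% M))
          (nth 0 (map enc ys) i)]
    & forall y a b, y \in dn -> y \notin ms -> adj G y a -> adj G y b ->
        mat ms (t %/ M) = enc a -> mat ms (t %% M) = enc b -> size ys < l -> y \in ys].

Definition pair_index ms (a b : 'I_n) := index a ms * M + index b ms.

(** [mo_cover] reflects that each matching edge has an end in [S], and it bounds [size ms]. By
    [mo_closed] a finished unmatched vertex has only matched neighbours, so it is never matched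
    later. *)
Record matching_ok dn ms s : Prop := MatchingOk {
  mo_mat : forall p, s Mat p = mat ms p;
  mo_num : s NumM 0 = size ms;
  mo_uniq : uniq ms;
  mo_cover : size ms <= 2 * count (mem S) ms;
  mo_closed : forall y x, y \in dn -> y \notin ms -> adj G y x -> x \in ms }.

(** An edge inside [ms] is recorded at the latest when the second of its ends is finished, under the
    pair whose second entry is that end; hence the disjunction in [so_edge]. *)
Record slots_ok dn ms s : Prop := SlotsOk {
  so_sound : sound s;
  so_edge : forall a b, a \in ms -> b \in ms -> a \in dn -> b \in dn -> adj G a b ->
    edge_slot ms s (pair_index ms a b) \/ edge_slot ms s (pair_index ms b a);
  so_pair : forall t, t < M * M -> pair_slots dn ms s t }.

(** [r] collects the neighbours read so far. [co_match] expresses greediness: every edge read has an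
    end in [ms]. *)
Record current_ok dn ms y r s : Prop := CurrentOk {
  co_cur : s Cur 0 = enc y;
  co_new : y \notin dn;
  co_in : s InM 0 = (y \in ms);
  co_nbr : forall p, p < M -> s Nbr p = has (fun x => mat ms p == enc x) r;
  co_adj : forall x, x \in r -> adj G y x;
  co_match : forall x, x \in r -> (x \in ms) || (y \in ms) }.

Lemma matching_size dn ms s : matching_ok dn ms s -> size ms <= M.
Proof.
move=> [_ _ um cm _]; have: count (mem S) ms <= #|S|.
  rewrite -size_filter cardE; apply: uniq_leq_size; first exact: filter_uniq.
  by move=> x; rewrite mem_filter mem_enum => /andP[].
by move=> h; move: h SK cm; clear; rewrite /max_matched; lia.
Qed.

Lemma pair_index_lt ms a b : size ms <= M -> a \in ms -> b \in ms ->
  [/\ pair_index ms a b < M * M, pair_index ms a b %/ M = index a ms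
    & pair_index ms a b %% M = index b ms].
Proof.
move=> sm am bm; have ia : index a ms < M by apply: leq_trans sm; rewrite index_mem.
have ib : index b ms < M by apply: leq_trans sm; rewrite index_mem.
rewrite /pair_index divnMDl ?M_gt0 // divn_small // addn0 modnMDl modn_small //.
split=> //; apply: (@leq_trans ((index a ms).+1 * M)); last by rewrite leq_mul2r ia orbT.
by rewrite mulSn addnC ltn_add2r.
Qed.

Lemma div_lt t : t < M * M -> t %/ M < M.
Proof. by move=> h; rewrite ltn_divLR // M_gt0. Qed.

Lemma mod_lt t : t %% M < M.
Proof. by rewrite ltn_mod M_gt0. Qed.

Definition put3 s j a b c := upd (upd (upd s EndA j a) EndB j b) Mid j c.

Lemma stored_put3 s j a b c : stored (put3 s j a b c) j a b c.
Proof. by rewrite /stored /put3 /upd /= eqxx. Qed.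

Lemma stored_put3_ne s j a b c j' a' b' c' : j' <> j ->
  stored (put3 s j a b c) j' a' b' c' <-> stored s j' a' b' c'.
Proof. by move/eqP/negbTE => e; rewrite /stored /put3 /upd /= e. Qed.

Lemma sound_put3 s j (a b y : 'I_n) : sound s -> adj G a y -> adj G b y ->
  sound (put3 s j (enc a) (enc b) (enc y)).
Proof.
move=> h ay yb j'; case: (eqVneq j' j) => [->|/eqP ne].
  by right; exists a, b, y; split=> //; apply: stored_put3.
case: (h j') => [h0|[a' [b' [y' [h1 h2 h3]]]]].
  by left; move: ne; rewrite /put3 /upd /= => /eqP/negbTE ->.
by right; exists a', b', y'; split=> //; apply/stored_put3_ne.
Qed.

(** The quantified premises say that the address [j] and the end [b] do not depend on the cells
    written before they are evaluated. *)
Lemma wp_put_slot j a b (Q : state -> seq token -> Prop) s ts :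
  let s' := put3 s (ev s j) (ev s a) (ev s b) (s Cur 0) in
  ev s j < J -> ev s a <= n -> ev s b <= n -> s Cur 0 <= n ->
  (forall x, ev (upd s EndA (ev s j) x) j = ev s j /\
     ev (upd s EndA (ev s j) x) b = ev s b) ->
  (forall x y, ev (upd (upd s EndA (ev s j) x) EndB (ev s j) y) j = ev s j) ->
  Q s' ts -> wp (put_slot j a b) Q s ts.
Proof.
move=> s' jJ an bn cn h1 h2 q; apply: wp_seq; apply: (wp_put ix_space); try lia.
have [e1 e2] := h1 (ev s a).
apply: wp_seq; apply: (wp_put ix_space); rewrite ?e1 ?e2; try lia.
by apply: (wp_put ix_space); rewrite ?h2 //=; rewrite /upd /=; lia.
Qed.

Lemma pair_slots_put3 dn ms s t j a b c : pair_slots dn ms s t ->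
  (forall i, i < l -> t * (l + 1) + i <> j) -> pair_slots dn ms (put3 s j a b c) t.
Proof.
move=> [ys [h1 h2 h3 h4]] hj; exists ys; split=> // i il.
have [? ? ?] := h3 i il; split=> //; apply/stored_put3_ne => //.
by apply: hj; case: h1 => _ _; apply: leq_trans.
Qed.

Lemma pair_slots_Cnt dn ms s t t' x : t' <> t -> pair_slots dn ms s t' ->
  pair_slots dn ms (upd s Cnt t x) t'.
Proof.
move=> /eqP/negbTE ne [ys [[h0 h1 h2] h3 h4 h5]]; exists ys; split=> //; split=> //.
by rewrite h1 /upd /= ne.
Qed.

(** The extended list stays duplicate-free because the recorded vertices lie in [dn] and [y] does
    not. *)
Lemma pair_slots_add dn ms s t y :
  y \notin dn -> t %/ M < size ms -> t %% M < size ms -> s Cnt t < l ->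
  pair_slots dn ms s t ->
  pair_slots (y :: dn) ms
    (upd (put3 s (t * (l + 1) + s Cnt t) (mat ms (t %/ M)) (mat ms (t %% M)) (enc y))
       Cnt t (s Cnt t).+1) t.
Proof.
move=> ydn tp tq cl [ys [[h0 h1 h2] h3 h4 h5]]; exists (rcons ys y); split.
- rewrite rcons_uniq size_rcons h0 andbT /upd /= eqxx h1; split=> //.
  by apply: contra ydn; apply: h3.
- by move=> z; rewrite mem_rcons !inE => /orP[->//|/h3 ->]; rewrite orbT.
- move=> i; rewrite size_rcons ltnS leq_eqVlt map_rcons nth_rcons size_map => /orP[/eqP ->|il].
    rewrite ltnn eqxx h1; split=> //; exact: stored_put3.
  rewrite il; have [? ? st] := h4 i il; split=> //.
  by apply/(@stored_put3_ne s) => // /slot_inj[]; lia.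
- move=> z a b; rewrite inE size_rcons mem_rcons inE; case: eqVneq => //= _ zdn zm za zb pa pb sl.
  by apply: h5 zb pa pb _ => //; lia.
Qed.

(** Covers the two reasons for recording nothing: the quota is reached, or [y] is not a common
    neighbour of the pair. *)
Lemma pair_slots_skip dn ms s t y :
  (s Cnt t < l -> forall a b, mat ms (t %/ M) = enc a -> mat ms (t %% M) = enc b ->
     ~~ (adj G y a && adj G y b)) ->
  pair_slots dn ms s t -> pair_slots (y :: dn) ms s t.
Proof.
move=> skip [ys [[h0 h1 h2] h3 h4 h5]]; exists ys; split=> //.
  by move=> z /h3; rewrite inE => ->; rewrite orbT.
move=> z a b; rewrite inE => /orP[/eqP ->|]; last exact: h5.
by move=> _ ya yb pa pb sl; have := skip _ a b pa pb; rewrite -h1 ya yb => /(_ sl).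
Qed.

Lemma wp_finish_vertex dn ms y r s ts :
  matching_ok dn ms s -> slots_ok dn ms s -> current_ok dn ms y r s ->
  (forall x, adj G y x -> x \in r) ->
  wp finish_vertex (fun s' ts' => [/\ ts' = ts,
    same [:: Idx; Cnt; EndA; EndB; Mid] s s',
    matching_ok (y :: dn) ms s' & slots_ok (y :: dn) ms s']) s ts.
Proof.
move=> mo so co all_r; have sM := matching_size mo.
have nb p : p < M -> s Nbr p != 0 -> exists a, mat ms p = enc a /\ adj G y a.
  move=> pM; rewrite (co_nbr co) //; case: hasP => // -[a ar /eqP e] _.
  by exists a; split=> //; apply: (co_adj co).
have nb' p a : p < M -> mat ms p = enc a -> adj G y a -> s Nbr p = 1.
  move=> pM e ya; rewrite (co_nbr co) //; case: hasP => // -[]; exists a; first exact: all_r.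
  by rewrite e.
pose rs := [:: Idx; Cnt; EndA; EndB; Mid].
(* After [t] iterations the pairs below [t] account for [y], the others only for [dn]; edges to [y]
   are recorded for the pairs below [t]. *)
pose I t s1 := [/\ same rs s s1, sound s1,
  forall t', t' < M * M -> pair_slots (if t' < t then y :: dn else dn) ms s1 t',
  forall t', edge_slot ms s t' -> edge_slot ms s1 t'
  & forall t', t' < t -> s Nbr (t' %/ M) != 0 -> mat ms (t' %% M) = enc y -> edge_slot ms s1 t'].
apply: (wp_for ix_space (I := I) (N := M * M)); first lia.
- by have := MM_J; lia.
- split=> //; first exact: same_upd.
  + exact: (so_sound so).
  + by move=> t' tM; rewrite ltn0; exact: (so_pair so).
- by [].
- move=> t s1 tM [sa so1 pa ed ed1] ti.
  have pM := div_lt tM; have qM := mod_lt t.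
  have em p : s1 Mat p = mat ms p by rewrite sa // (mo_mat mo).
  have en p : s1 Nbr p = s Nbr p by rewrite sa.
  have ec : s1 Cur 0 = enc y by rewrite sa // (co_cur co).
  apply: wp_seq.
  (* State between the two conditionals: the edge slot of [t] is settled, its path slots not yet. *)
  pose I2 s2 := [/\ I t s2, s2 Idx 0 = t & s Nbr (t %/ M) != 0 ->
    mat ms (t %% M) = enc y -> edge_slot ms s2 t].
  suff h2 s2 : I2 s2 -> wp (IfX (Nbr.[!Idx %/ xM] * Nbr.[!Idx %% xM] * (Cnt.[!Idx] <? xl))
      (put_slot (xslot !Idx Cnt.[!Idx]) Mat.[!Idx %/ xM] Mat.[!Idx %% xM] ;;
       Put Cnt !Idx (Cnt.[!Idx] + #1)) Skip)
      (fun s' ts' => [/\ ts' = ts, s' Idx 0 = t & I t.+1 (upd s' Idx 0 t.+1)]) s2 ts.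
    apply: wp_if => /=; rewrite !evE ti !en !em ec; last first.
      move=> h; apply: wp_skip; apply: h2; split=> // np mq.
      by move: h np; rewrite mq eqxx muln1 => ->.
    rewrite muln_eq0 negb_or eqb0 negbK => /andP[np /eqP mq].
    have [a [pa_ ya]] := nb _ pM np.
    apply: wp_put_slot => //=; rewrite ?evE ?ti ?em ?ec ?pa_ ?mat_lt ?enc_lt ?slot_lt //.
    apply: h2; split=> //; last first.
      by move=> _ _; rewrite /edge_slot pa_ mq; exact: stored_put3.
    have st t' : edge_slot ms s1 t' -> edge_slot ms
        (put3 s1 (t * (l + 1) + l) (enc a) (enc a) (enc y)) t'.
      case: (eqVneq t' t) => [-> _|/eqP ne e].
        by rewrite /edge_slot pa_ mq; exact: stored_put3.
      by apply/stored_put3_ne => // /slot_inj[].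
    split=> //.
    + by do 3!apply: same_upd => //.
    + by apply: sound_put3; rewrite // adj_sym.
    + move=> t' t'M; apply: pair_slots_put3; first exact: pa.
      by move=> i il /slot_inj[]; lia.
    + by move=> t' /ed /st.
    + by move=> t' h1 h3 h4; apply: st; apply: ed1.
  clear sa so1 pa ed ed1 ti em en ec s1.
  move=> [[sa so1 pa ed ed1] ti ed2].
  have em p : s2 Mat p = mat ms p by rewrite sa // (mo_mat mo).
  have en p : s2 Nbr p = s Nbr p by rewrite sa.
  have ec : s2 Cur 0 = enc y by rewrite sa // (co_cur co).
  have pat : pair_slots dn ms s2 t by have := pa t tM; rewrite ltnn.
  have pan t' : t' != t -> t' < M * M -> pair_slots (if t' < t.+1 then y :: dn else dn) ms s2 t'.
    by move=> ne t'M; rewrite ltnS leq_eqVlt (negbTE ne) /=; exact: pa.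
  have edS (s3 : state) : (forall t', edge_slot ms s2 t' -> edge_slot ms s3 t') ->
      forall t', t' < t.+1 -> s Nbr (t' %/ M) != 0 -> mat ms (t' %% M) = enc y -> edge_slot ms s3 t'.
    move=> h t'; rewrite ltnS leq_eqVlt => /orP[/eqP -> h1 h3|h0 h1 h3]; apply: h.
      exact: ed2.
    exact: ed1.
  apply: wp_if => /=; rewrite !evE ti !en.
    rewrite !muln_eq0 !negb_or => /andP[/andP[np nq] cl].
    have {}cl : s2 Cnt t < l by move: cl; case: (_ < _).
    have [a [pa_ ya]] := nb _ pM np; have [b [qb yb]] := nb _ qM nq.
    have [ps _] := matP pa_; have [qs _] := matP qb.
    apply: wp_seq; apply: wp_put_slot => //=;
      rewrite ?evE ?ti ?em ?ec ?mat_lt ?enc_lt ?slot_lt // 1?ltnW //.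
    set s3 := put3 _ _ _ _ _.
    have e1 : s3 Idx 0 = t by [].
    have e2 : s3 Cnt t = s2 Cnt t by [].
    apply: (wp_put ix_space) => /=; rewrite e1 ?e2; first by have := MM_J; lia.
      by have := slot_lt tM (leqnn l); lia.
    rewrite addn1; set s4 := upd s3 _ _ _.
    have es3 : s4 = upd (put3 s2 (t * (l + 1) + s2 Cnt t) (mat ms (t %/ M))
        (mat ms (t %% M)) (enc y)) Cnt t (s2 Cnt t).+1 by [].
    split=> //; split.
    + by rewrite es3; do 5!apply: same_upd => //.
    + by rewrite es3 pa_ qb; apply: sound_put3; rewrite // adj_sym.
    + move=> t' t'M; case: (eqVneq t' t) => [->|ne].
        by rewrite ltnSn es3; exact: pair_slots_add (co_new co) ps qs cl pat.
      rewrite es3; apply: (@pair_slots_Cnt _ _ (put3 s2 _ _ _ _)); first exact/eqP.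
      apply: pair_slots_put3; first exact: pan.
      by move=> i il /slot_inj[]; move/eqP: ne; lia.
    + move=> t' /ed h; rewrite es3; apply/(@stored_put3_ne s2) => // /slot_inj[]; lia.
    + apply: edS => t' h; rewrite es3; apply/(@stored_put3_ne s2) => // /slot_inj[]; lia.
  move=> h; apply: wp_skip; split=> //; split=> //; first exact: same_upd.
  + move=> t' t'M; case: (eqVneq t' t) => [->|ne]; last exact: pan.
    rewrite ltnSn; apply: (@pair_slots_skip _ _ s2) => // cl a b pa_ qb.
    apply/negP => /andP[ya yb]; move: h.
    by rewrite (nb' _ _ pM pa_ ya) (nb' _ _ qM qb yb) cl.
  + exact: edS.
move=> s' [sa so1 pa ed ed1] _; split=> //.
- split; [by move=> p; rewrite sa // (mo_mat mo)|by rewrite sa // (mo_num mo)|..].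
  + exact: (mo_uniq mo).
  + exact: (mo_cover mo).
  (* An unmatched [y] has all its neighbours in [ms], since [co_match] now covers its complete
     list. *)
  + move=> z x; rewrite inE => /orP[/eqP -> ym yx|]; last exact: (mo_closed mo).
    by have := co_match co (all_r _ yx); rewrite (negbTE ym) orbF.
- split=> //; last by move=> t tM; have := pa t tM; rewrite tM.
  have new a : a \in ms -> y \in ms -> adj G a y -> edge_slot ms s' (pair_index ms a y).
    move=> am ym ay; have [h1 h2 h3] := pair_index_lt sM am ym.
    apply: ed1 => //; rewrite ?h2 ?h3 ?mat_index //.
    by rewrite (nb' _ a) ?mat_index // ?(adj_sym _ y) // -h2 div_lt.
  move=> a b am bm; rewrite !inE.
  case: (eqVneq b y) bm => [-> ym _ _ ab|_ bm]; first by left; apply: new.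
  case: (eqVneq a y) am => [-> ym _ _ ab|_ am /= ad bd ab]; first by right; apply: new; rewrite // adj_sym.
  by case: (so_edge so am bm ad bd ab) => h; [left|right]; apply: ed.
Qed.

Lemma wp_start_vertex dn ms y s ts :
  matching_ok dn ms s -> y \notin dn -> s Tok 0 = y ->
  wp start_vertex (fun s' ts' => [/\ ts' = ts,
    same [:: Idx; Cur; InM; Nbr] s s' & current_ok dn ms y [::] s']) s ts.
Proof.
move=> mo yd ty; have sM := matching_size mo.
have yn := enc_lt y.
apply: wp_seq; apply: (wp_put ix_space) => /=; rewrite ?ty; [lia|rewrite /enc in yn; lia|].
apply: wp_seq; apply: (wp_put ix_space) => /=; [lia|lia|].
set s1 := upd _ InM 0 0.
have s1s : same [:: Idx; Cur; InM; Nbr] s s1 by do 2!apply: same_upd => //.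
have s1c : s1 Cur 0 = enc y by rewrite /s1 /upd /= addn1.
pose I i s2 := [/\ same [:: Idx; Cur; InM; Nbr] s s2, s2 Cur 0 = enc y,
  forall p, p < i -> s2 Nbr p = 0 &
  s2 InM 0 = has (fun p => mat ms p == enc y) (iota 0 i)].
apply: (wp_for ix_space (I := I) (N := M)); first lia.
- by have := M_MM; have := MM_J; lia.
- by split=> //; apply: same_upd.
- by [].
- move=> i s2 iM [sa sc sn si] ei.
  have iJ : i < J by have := M_MM; have := MM_J; lia.
  apply: wp_seq; apply: (wp_put ix_space) => /=; rewrite ?ei; [lia|lia|].
  have em p : s2 Mat p = mat ms p by rewrite sa // (mo_mat mo).
  have nb p (s3 : state) : p < i.+1 -> s3 Nbr = upd s2 Nbr i 0 Nbr -> s3 Nbr p = 0.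
    rewrite ltnS leq_eqVlt => pi ->; rewrite /upd /=; case: eqP pi => //= _; exact: sn.
  have ein : has (fun p => mat ms p == enc y) (iota 0 i.+1) =
      has (fun p => mat ms p == enc y) (iota 0 i) || (mat ms i == enc y).
    by rewrite -addn1 iotaD has_cat /= orbF.
  apply: wp_if => /=; rewrite !updE /= ei em sc => h.
    apply: (wp_put ix_space) => /=; [lia|lia|].
    split=> //; split=> //; first by do 3!apply: same_upd => //.
      by move=> p pi; apply: (nb p).
    by rewrite ein updE /=; move: h; case: (mat ms i == _); rewrite ?orbT.
  apply: wp_skip; split=> //; split=> //; first by do 2!apply: same_upd => //.
    by move=> p pi; apply: (nb p).
  by rewrite ein !updE /= si; move: h; case: (mat ms i == _); rewrite ?orbF.
move=> s' [sa sc sn si] _; split=> //; split=> //.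
rewrite si; congr nat_of_bool; apply/hasP/idP => [[p _ /eqP /matP[]] //|ym].
exists (index y ms); last by rewrite mat_index.
by rewrite mem_iota /= add0n (leq_trans _ sM) // index_mem.
Qed.

(** A new matching edge is appended to [ms], so old positions, pair indices and slots keep their
    meaning. *)
Lemma wp_read_edge dn ms y r u s ts :
  matching_ok dn ms s -> slots_ok dn ms s -> current_ok dn ms y r s ->
  adj G y u -> s Tok 0 = u ->
  wp read_edge (fun s' ts' => [/\ ts' = ts, s' Done = s Done & exists ms',
    [/\ matching_ok dn ms' s', slots_ok dn ms' s' & current_ok dn ms' y (u :: r) s']]) s ts.
Proof.
move=> mo so co yu tu; have sM := matching_size mo.
have MJ : M <= J by have := M_MM; have := MM_J; lia.
apply: wp_seq; apply: (wp_put ix_space) => /=; [lia|lia|].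
pose I i s2 := [/\ same [:: Idx; Found; Nbr] s s2,
  forall p, p < M -> s2 Nbr p = (s Nbr p != 0) || ((p < i) && (mat ms p == enc u)) &
  s2 Found 0 = has (fun p => mat ms p == enc u) (iota 0 i)].
apply: wp_seq; apply: (wp_for ix_space (I := I) (N := M)); first lia.
- lia.
- split=> //; first by do 2!apply: same_upd => //.
  by move=> p pM; rewrite /upd /= orbF (co_nbr co) //; case: (has _ _).
- by [].
- move=> i s2 iM [sa sn sf] ei.
  have em p : s2 Mat p = mat ms p by rewrite sa // (mo_mat mo).
  have ein : has (fun p => mat ms p == enc u) (iota 0 i.+1) =
      has (fun p => mat ms p == enc u) (iota 0 i) || (mat ms i == enc u).
    by rewrite -addn1 iotaD has_cat /= orbF.
  have et : s2 Tok 0 + 1 = enc u by rewrite sa // tu addn1.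
  apply: wp_if => /=; rewrite ei em et => h.
    apply: wp_seq; apply: (wp_put ix_space) => /=; rewrite ?ei; [lia|lia|].
    apply: (wp_put ix_space) => /=; [lia|lia|].
    split=> //; split=> //; first by do 3!apply: same_upd => //.
      move=> p pM; rewrite /upd /= ltnS leq_eqVlt.
      case: (eqVneq p i) => [->|_] /=; last exact: sn.
      by move: h; case: (mat ms i == _); rewrite ?orbT.
    by rewrite ein updE /=; move: h; case: (mat ms i == _); rewrite ?orbT.
  apply: wp_skip; split=> //; split=> //; first by do 2!apply: same_upd => //.
    move=> p pM; rewrite /upd /= ltnS leq_eqVlt sn //.
    case: (eqVneq p i) => [->|_] //=.
    by move: h; case: (mat ms i == _); rewrite ?andbF.
  by rewrite ein !updE /= sf; move: h; case: (mat ms i == _); rewrite ?orbF.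
move=> s2 [sa sn sf] _.
have {}sn p : p < M -> s2 Nbr p = has (fun x => mat ms p == enc x) (u :: r).
  move=> pM; rewrite sn // pM (co_nbr co) //= orbC.
  by case: (has _ _); case: (_ == _).
have {}sf : s2 Found 0 = (u \in ms).
  rewrite sf; congr nat_of_bool; apply/hasP/idP => [[p _ /eqP /matP[]] //|um].
  exists (index u ms); last by rewrite mat_index.
  by rewrite mem_iota /= add0n (leq_trans _ sM) // index_mem.
have mo2 : matching_ok dn ms s2.
  by case: mo => *; split=> //; [move=> p|]; rewrite sa.
have st2 j a b c : stored s j a b c -> stored s2 j a b c.
  by rewrite /stored !sa.
have so2 : slots_ok dn ms s2.
  case: so => so1 so2 so3; split.
  - move=> j; rewrite sa //; case: (so1 j) => [->|[a [b [z [h1 h2 h3]]]]]; first by left.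
    by right; exists a, b, z; split=> //; apply: st2.
  - by move=> a b am bm ad bd ab; case: (so2 a b am bm ad bd ab) => h; [left|right]; apply: st2.
  - move=> t /so3[ys [h1 h2 h3 h4]]; exists ys; split=> //; first by rewrite sa.
    by move=> i /h3[? ? ?]; split=> //; apply: st2.
have co2 : (u \in ms) || (y \in ms) -> current_ok dn ms y (u :: r) s2.
  move=> uy; case: co => c1 c2 c3 c4 c5 c6; split=> //; rewrite ?sa //.
    by move=> x; rewrite inE => /orP[/eqP ->|/c5].
  by move=> x; rewrite inE => /orP[/eqP ->|/c6].
have eD : s2 Done = s Done by apply: functional_extensionality => i; rewrite sa.
have ei2 : s2 InM 0 = (y \in ms) by rewrite sa // (co_in co).
apply: wp_if; rewrite /= sf => um.
  apply: wp_skip; split=> //; exists ms; split=> //; apply: co2.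
  by move: um; case: (u \in ms).
apply: wp_if; rewrite /= ei2 => ym.
  apply: wp_skip; split=> //; exists ms; split=> //; apply: co2.
  by move: ym; case: (y \in ms); rewrite ?orbT.
have {}um : u \notin ms by move: um; case: (u \in ms).
have {}ym : y \notin ms by move: ym; case: (y \in ms).
clear co2.
pose ms' := ms ++ [:: u; y].
have eu : s2 Tok 0 + 1 = enc u by rewrite sa // tu addn1.
have ey : s2 Cur 0 = enc y by rewrite sa // (co_cur co).
have en := mo_num mo2.
have un := enc_lt u; have yn := enc_lt y.
have um' : uniq ms'.
  rewrite cat_uniq (mo_uniq mo) /= orbF negb_or um ym inE andbT /=.
  by rewrite andbT; apply: contraTN yu => /eqP ->; rewrite adj_irr.
have cm' : size ms' <= 2 * count (mem S) ms'.
  rewrite size_cat count_cat /=; have := mo_cover mo.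
  by have := VC yu; case: (u \in S); case: (y \in S) => //= _; lia.
set fin := (X in wp _ X).
have mat_u : mat ms' (size ms) = enc u by rewrite /mat map_cat nth_cat size_map ltnn subnn.
have mat_y : mat ms' (size ms).+1 = enc y.
  by rewrite /mat map_cat nth_cat size_map ltnNge leqnSn /= subSnn.
have mat_o p : p <> size ms -> p <> (size ms).+1 -> mat ms' p = mat ms p.
  move=> h1 h2; case: (ltnP p (size ms)) => h; first exact: mat_cat.
  by rewrite /mat !nth_default ?size_map ?size_cat //=; lia.
have sM' : size ms' <= M.
  (* An artificial state with nothing finished, which lets [matching_size] bound the extended list
     before it is written to memory. *)
  have mo' : matching_ok [::] ms' (fun q i => if code q == code Mat then mat ms' i else size ms').
    by split.
  exact: matching_size mo'.
rewrite size_cat /= in sM'.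
apply: wp_seq; apply: (wp_put ix_space) => /=; rewrite ?en ?eu; [lia|lia|].
apply: wp_seq; apply: (wp_put ix_space) => /=; rewrite ?updE /= ?en ?ey; [lia|lia|].
apply: wp_seq; apply: (wp_put ix_space) => /=; rewrite ?updE /= ?en; [lia|lia|].
apply: wp_seq; apply: (wp_put ix_space) => /=; rewrite ?updE /= ?en; [lia|lia|].
apply: (wp_put ix_space) => /=; [lia|lia|].
set s3 := upd _ InM 0 1.
have st3 j a b c : stored s2 j a b c -> stored s3 j a b c by [].
(* No finished vertex enters the matching: a finished unmatched [u] would force its neighbour [y]
   into [ms], and [y] itself is not finished. *)
have old a : a \in ms' -> a \in dn -> a \in ms.
  rewrite mem_cat !inE => /orP[//|/orP[/eqP ->|/eqP ->]] adn.
    by case/negP: ym; apply: (mo_closed mo) adn um _; rewrite adj_sym.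
  by case/negP: (co_new co).
have subm a : a \in ms -> a \in ms' by rewrite mem_cat => ->.
rewrite /fin; split=> //; exists ms'; split.
- split=> //.
  + move=> p; case: (eqVneq p (size ms)) => [->|p1].
      by rewrite /s3 !updE /= eqxx addn1 mat_u; case: eqP => //; lia.
    case: (eqVneq p (size ms).+1) => [->|p2].
      by rewrite /s3 !updE /= addn1 eqxx mat_y.
    rewrite /s3 !updE /= addn1 (negbTE p1) (negbTE p2) (mo_mat mo2).
    by rewrite mat_o //; apply/eqP.
  + by rewrite /s3 !updE /= size_cat.
  + move=> z x zdn zm zx; apply: (subm); apply: (mo_closed mo) zdn _ zx.
    by apply: contra zm; apply: (subm).
- have ed a b : a \in ms -> b \in ms -> edge_slot ms s2 (pair_index ms a b) ->
      edge_slot ms' s3 (pair_index ms' a b).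
    move=> am bm; rewrite /edge_slot.
    have -> : pair_index ms' a b = pair_index ms a b by rewrite /pair_index !index_cat am bm.
    have [_ -> ->] := pair_index_lt sM am bm.
    by rewrite !mat_cat ?index_mem.
  split.
  + exact: (so_sound so2).
  + move=> a b am bm adn bdn ab; have {}am := old _ am adn; have {}bm := old _ bm bdn.
    by case: (so_edge so2 am bm adn bdn ab) => h; [left|right]; apply: ed.
  + move=> t /(so_pair so2)[ys [h1 h2 h3 h4]]; exists ys; split=> //.
      move=> i /h3[p1 p2 h]; rewrite !mat_cat // size_cat /=.
      by split=> //; apply: ltn_addr.
    move=> z a b zdn zm za zb pa pb sl.
    have zm' : z \notin ms by apply: contra zm; apply: (subm).
    (* Finished vertices outside the matching have all their neighbours in the old [ms], so pairs
       involving the two new entries demand nothing. *)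
    have am := mo_closed mo zdn zm' za; have bm := mo_closed mo zdn zm' zb.
    apply: (h4 z a b) => //.
      by rewrite (mat_inj um' pa) index_cat am mat_index.
    by rewrite (mat_inj um' pb) index_cat bm mat_index.
- split.
  + by [].
  + exact: (co_new co).
  + by rewrite /s3 !updE /= mem_cat !inE eqxx !orbT.
  + move=> p pM; rewrite /s3 !updE /= sn //=.
    case: (eqVneq p (size ms)) => [->|p1]; first by rewrite mat_u eqxx.
    have xm x : x \in r -> x \in ms by move=> /(co_match co); rewrite (negbTE ym) orbF.
    have e x : x \in ms -> (mat ms' p == enc x) = (mat ms p == enc x).
      move=> xm'; apply/eqP/eqP => [h|h]; last by case: (matP h) => h' _; rewrite mat_cat.
      by rewrite (mat_inj um' h) index_cat xm' mat_index.
    have -> : (mat ms p == enc u) = false by apply/eqP => /matP[_]; apply/negP.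
    have -> : (mat ms' p == enc u) = false.
      apply/eqP => h; have := mat_inj um' h; rewrite (mat_inj um' mat_u) in p1 => e'.
      by rewrite e' eqxx in p1.
    by congr nat_of_bool; apply: eq_in_has => x /xm /e.
  + by move=> x; rewrite inE => /orP[/eqP ->|/(co_adj co)].
  + by move=> x _; rewrite [y \in _]mem_cat !inE eqxx !orbT.
Qed.

(** * The loop over the whole stream *)

Definition flush : cmd := IfX !Cur finish_vertex Skip.

Definition processed dn s := exists ms, matching_ok dn ms s /\ slots_ok dn ms s.

(** Covers both the start, where [flush] does nothing, and a vertex whose list is complete. The
    value [v] is arbitrary because the next token is stored in [Tok] before the flush. *)
Definition ready dn s := s Done 0 = 0 /\ forall v ts,
  wp flush (fun s' ts' => [/\ ts' = ts, s' Done 0 = 0, s' Tok 0 = v & processed dn s'])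
    (upd s Tok 0 v) ts.

(** The remainder of the stream enters as the continuation [fin], since one while loop consumes all
    tokens. *)
Lemma wp_read_edges dn y us ms r s ts Q :
  s Done 0 = 0 -> matching_ok dn ms s -> slots_ok dn ms s -> current_ok dn ms y r s ->
  (forall u, u \in us -> adj G y u) ->
  (forall ms' s' r', s' Done 0 = 0 -> matching_ok dn ms' s' -> slots_ok dn ms' s' ->
     current_ok dn ms' y r' s' -> {subset us ++ r <= r'} -> wp read_stream Q s' ts) ->
  wp read_stream Q s ([seq Edge (val u) | u <- us] ++ ts).
Proof.
elim: us ms r s => [|u us IH] ms r s d0 mo so co yus fin /=.
  exact: fin mo so co _.
apply: wp_while => /=; rewrite d0 // => _.
have un := ltn_ord u.
apply: (wp_get_edge ix_space); [lia|lia|].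
set s1 := upd s Tok 0 u.
have mo1 : matching_ok dn ms s1 by case: mo => *; split.
have so1 : slots_ok dn ms s1 by case: so => *; split.
have co1 : current_ok dn ms y r s1 by case: co => *; split.
apply: wp_conseq (wp_read_edge (u := u) _ mo1 so1 co1 _ _); last 2 first.
- by apply: yus; rewrite inE eqxx.
- by [].
move=> s' ts' [-> e [ms' [mo' so' co']]].
apply: (IH ms' (u :: r)) => //; first by rewrite e.
  by move=> x xus; apply: yus; rewrite inE xus orbT.
move=> ms2 s2 r2 h1 h2 h3 h4 h5; apply: (fin ms2 s2 r2) => // x hx; apply: h5.
by move: hx; rewrite /= !(inE, mem_cat); case: (x == u); rewrite ?orbT.
Qed.

Lemma current_ready dn ms y r s :
  s Done 0 = 0 -> matching_ok dn ms s -> slots_ok dn ms s -> current_ok dn ms y r s ->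
  (forall x, adj G y x -> x \in r) -> ready (y :: dn) s.
Proof.
move=> d0 mo so co all_r; split=> // v ts.
set s1 := upd s Tok 0 v.
have mo1 : matching_ok dn ms s1 by case: mo => *; split.
have so1 : slots_ok dn ms s1 by case: so => *; split.
have co1 : current_ok dn ms y r s1 by case: co => *; split.
apply: wp_if => /=; last by rewrite (co_cur co1).
move=> _; apply: wp_conseq (wp_finish_vertex _ mo1 so1 co1 all_r).
move=> s' ts' [-> sa mo' so']; split=> //; last by exists ms.
  by rewrite sa.
by rewrite sa.
Qed.

Lemma wp_read_stream (nb : 'I_n -> seq 'I_n) vs dn s (Q : state -> seq token -> Prop) :
  (forall v u, (u \in nb v) = adj G v u) -> uniq vs -> (forall v, v \in vs -> v \notin dn) ->
  ready dn s ->
  (forall s' dn', processed dn' s' -> {subset vs ++ dn <= dn'} -> Q s' [::]) ->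
  wp read_stream Q s
    (flatten [seq Expose (val v) :: [seq Edge (val u) | u <- nb v] | v <- vs]).
Proof.
move=> nbE; elim: vs dn s => [|v vs IH] dn s uvs ndn [d0 rdy] fin /=.
  apply: wp_while => /=; rewrite d0 // => _; apply: wp_get_end; apply: wp_seq.
  (* At the end of the stream no token is stored, so [ready] is used with the present value of
     [Tok]. *)
  have := rdy (s Tok 0) [::]; rewrite upd_id; apply: wp_conseq.
  move=> s' _ [-> d0' _ pr]; apply: (wp_put ix_space) => /=; [lia|lia|].
  suff: wp read_stream Q (upd s' Done 0 1) [::] by [].
  apply: wp_while => //= _; apply: (fin _ dn) => //.
  by case: pr => ms [mo so]; exists ms; split; [case: mo => *; split|case: so => *; split].
apply: wp_while => /=; rewrite d0 // => _.
have vn := ltn_ord v.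
apply: (wp_get_expose ix_space); [lia|lia|].
apply: wp_seq; apply: wp_conseq (rdy _ _) => s1 _ [-> d1 t1 [ms [mo so]]].
have vdn : v \notin dn by apply: ndn; rewrite inE eqxx.
apply: wp_conseq (wp_start_vertex _ mo vdn t1) => s2 _ [-> sa co].
have mo2 : matching_ok dn ms s2.
  by case: mo => *; split=> //; [move=> p|]; rewrite sa.
have st2 j a b c : stored s1 j a b c -> stored s2 j a b c.
  by rewrite /stored !sa.
have so2 : slots_ok dn ms s2.
  case: so => so1 so2 so3; split.
  - move=> j; rewrite sa //; case: (so1 j) => [->|[a [b [z [h1 h2 h3]]]]]; first by left.
    by right; exists a, b, z; split=> //; apply: st2.
  - by move=> a b am bm ad bd ab; case: (so2 a b am bm ad bd ab) => h; [left|right]; apply: st2.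
  - move=> t /so3[ys [h1 h2 h3 h4]]; exists ys; split=> //; first by rewrite sa.
    by move=> i /h3[? ? ?]; split=> //; apply: st2.
apply: (wp_read_edges _ mo2 so2 co); first by rewrite sa.
  by move=> u; rewrite nbE.
move=> ms' s' r' d' mo' so' co' sub_r.
have {}rdy : ready (v :: dn) s'.
  apply: current_ready mo' so' co' _ => // x vx.
  by apply: sub_r; rewrite cats0 nbE.
apply: IH rdy _.
- by case/andP: uvs.
- move=> w wvs; rewrite inE negb_or ndn ?inE ?wvs ?orbT // andbT.
  by apply: contraTneq wvs => ->; case/andP: uvs.
- move=> s3 dn' pr sub_dn; apply: fin pr _ => w hw; apply: sub_dn.
  by move: hw; rewrite /= !(inE, mem_cat); case: (w == v); rewrite ?orbT.
Qed.

End Stream.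

(** * Enumeration *)

(** Bounded existential quantifier over [v < hi]; [tb] is the register in which [body] leaves its
    truth value. *)
Definition any_loop t v hi body tb : cmd :=
  SetR t #0 ;; For v hi (body ;; IfX !tb (SetR t #1) Skip).

(** An odometer: the entries of [va] are the digits of a counter, least significant first. The carry
    out of the last digit ends the loop. *)
Definition any_vec t va len base body tb : cmd :=
  SetR t #0 ;; For Idx len (Put va !Idx #0) ;; SetR Stop #0 ;;
  While (cp (!Stop =? #0)) (
    body ;; IfX !tb (SetR t #1) Skip ;; SetR Carry #1 ;;
    For Idx len (
      SetR Digit (va.[!Idx] + !Carry) ;; Put va !Idx (!Digit %% base) ;;
      SetR Carry (!Digit %/ base)) ;;
    SetR Stop !Carry).

Definition digits B L i := mkseq (fun j => i %/ B ^ j %% B) L.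

Definition vectors B L := [seq digits B L i | i <- iota 0 (B ^ L)].

Lemma digitsS B L i : 0 < B -> digits B L.+1 i = (i %% B) :: digits B L (i %/ B).
Proof.
move=> B0; rewrite /digits /mkseq /= expn0 divn1; congr cons.
rewrite -[1]addn0 iotaDl -map_comp; apply: eq_map => j /=.
by rewrite add1n expnS divnMA.
Qed.

(** Every word over the digits below [B] is the expansion of a number below [B ^ L], rebuilt by the
    Horner scheme. *)
Lemma mem_vectors B L w : 0 < B -> (w \in vectors B L) = (size w == L) && all (gtn B) w.
Proof.
move=> B0; apply/mapP/andP => [[i _ ->]|[/eqP <- Bw]].
  rewrite size_mkseq; split=> //; apply/allP => x /mapP[j _ ->] /=.
  by rewrite ltn_mod.
elim: w Bw => [|x w IH] /=; first by exists 0.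
move=> /andP[xB /IH[i]]; rewrite mem_iota add0n => /= iB ew.
exists (x + i * B); last first.
  by rewrite digitsS // addnC modnMDl modn_small // divnMDl // divn_small // addn0 -ew.
rewrite mem_iota add0n expnS; apply: (@leq_trans (i.+1 * B)).
  by rewrite mulSn ltn_add2r.
by rewrite mulnC leq_mul2l iB orbT.
Qed.

Lemma hasP_vectors B L (P : pred (seq nat)) : 0 < B ->
  reflect (exists w, [/\ size w = L, all (gtn B) w & P w]) (has P (vectors B L)).
Proof.
move=> B0; apply: (iffP hasP) => [[w]|[w [sw bw Pw]]].
  by rewrite mem_vectors // => /andP[/eqP sw bw] Pw; exists w.
by exists w; rewrite // mem_vectors // sw eqxx.
Qed.

(* Invariant of the odometer: the carry into digit [d] is set iff [B ^ d]
   divides the new value [i.+1]. *)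
Lemma carry_step B d i : 0 < B ->
  let x := i %/ B ^ d %% B + (B ^ d %| i.+1) in
  x %% B = i.+1 %/ B ^ d %% B /\ x %/ B = (B ^ d.+1 %| i.+1).
Proof.
move=> B0 /=; rewrite divnS ?expn_gt0 ?B0 //; split.
  by rewrite modnDml addnC.
set q := i %/ B ^ d.
have hq : (q %% B < B) by rewrite ltn_mod.
case: (boolP (B ^ d %| i.+1)) => h; last first.
  have -> : (B ^ d.+1 %| i.+1) = false.
    by apply/negbTE; apply: contra h; apply: dvdn_trans; rewrite expnS dvdn_mull.
  by rewrite addn0 divn_small.
have -> : (B ^ d.+1 %| i.+1) = (B %| q.+1).
  rewrite -[i.+1](divnK h) expnS divnS ?expn_gt0 ?B0 // h add1n.
  by rewrite dvdn_pmul2r // expn_gt0 B0.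
rewrite addn1 divnS // [q %% B %/ B]divn_small // addn0.
by rewrite /dvdn -addn1 modnDml addn1.
Qed.

(** * Correctness of the exhaustive loops *)

Section Search.
Variables (n k K space word ix : nat).
Hypothesis ix_space : 32 * ix <= space.
Hypothesis ix_gt0 : 0 < ix.
Hypothesis word_gt2 : 2 < word.

Notation ev := (ev n k K).
Notation wp := (wp n k K space word).

Lemma wp_any t v hi body tb rs (P : pred nat) N s0 ts :
  uniq (map code [:: t; v]) ->
  ~~ has (fun r => code t == code r) rs -> ~~ has (fun r => code v == code r) rs ->
  N < word ->
  (forall s, same (t :: v :: rs) s0 s -> ev s hi = N) ->
  (forall s i ts, i < N -> same (t :: v :: rs) s0 s -> s v 0 = i ->
     wp body (fun s' ts' => [/\ ts' = ts, same rs s s' & s' tb 0 = P i]) s ts) ->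
  wp (any_loop t v hi body tb)
    (fun s' ts' => [/\ ts' = ts, same (t :: v :: rs) s0 s' & s' t 0 = has P (iota 0 N)])
    s0 ts.
Proof.
move=> /= /andP[]; rewrite inE => tv _ trs vrs Nw hN hb.
have mt s x : same (t :: v :: rs) s0 s -> same (t :: v :: rs) s0 (upd s t 0 x).
  by apply: same_upd; rewrite /= eqxx.
have mv s x : same (t :: v :: rs) s0 s -> same (t :: v :: rs) s0 (upd s v 0 x).
  by apply: same_upd; rewrite /= eqxx orbT.
apply: wp_seq; apply: (wp_put ix_space) => //=; first lia.
apply: (wp_for ix_space (N := N)
  (I := fun i s => same (t :: v :: rs) s0 s /\ s t 0 = has P (iota 0 i))) => //.
- by split; [apply: mv; apply: mt|rewrite !updE (negbTE tv) /= !eqxx].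
- by move=> i s [sa _]; apply: hN.
- move=> i s iN [sa st] vi.
  apply: wp_seq; apply: wp_conseq (hb _ _ _ iN sa vi) => s1 _ [-> sb eb].
  have sa1 : same (t :: v :: rs) s0 s1.
    apply: same_trans sa _; apply: same_sub sb => r /= ->; by rewrite !orbT.
  have /= eP : has P (iota 0 i.+1) = has P (iota 0 i) || P i.
    by rewrite -addn1 iotaD has_cat /= orbF.
  apply: wp_if => /= h.
    apply: (wp_put ix_space) => /=; [lia|lia|]; split=> //.
      by rewrite !updE eq_sym (negbTE tv) /= sb.
    split; first by apply: mv; apply: mt.
    rewrite eP !updE (negbTE tv) /= !eqxx /=.
    by move: h; rewrite eb; case: (P i); rewrite ?orbT.
  apply: wp_skip; split=> //; first by rewrite sb.
  split; first exact: mv.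
  rewrite eP updE (negbTE tv) /= sb // st.
  by move: h; rewrite eb; case: (P i); rewrite ?orbF.
- by move=> s [sa st] _.
Qed.

(** [rs] lists what the body may change. It must avoid [t] and [va] but may contain the registers of
    the odometer, which are set anew after each run of the body; thus nested odometers share
    them. *)
Lemma wp_any_vec t va len base body tb rs (P : pred (seq nat)) L B s0 ts :
  let rs' := [:: t, va, Idx, Stop, Carry, Digit & rs] in
  uniq (map code [:: t; va; Idx; Stop; Carry; Digit]) ->
  ~~ has (fun r => code t == code r) rs -> ~~ has (fun r => code va == code r) rs ->
  L < word -> L <= ix -> 0 < B -> B < word ->
  (forall s, same rs' s0 s -> ev s len = L) ->
  (forall s, same rs' s0 s -> ev s base = B) ->
  (forall s w ts, size w = L -> all (gtn B) w -> same rs' s0 s ->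
     (forall i, i < L -> s va i = nth 0 w i) ->
     wp body (fun s' ts' => [/\ ts' = ts, same rs s s' & s' tb 0 = P w]) s ts) ->
  wp (any_vec t va len base body tb)
    (fun s' ts' => [/\ ts' = ts, same rs' s0 s' & s' t 0 = has P (vectors B L)])
    s0 ts.
Proof.
move=> rs' /=; rewrite !inE !negb_or.
move=> /and3P[/and5P[t1 t2 t3 t4 t5] /and4P[v1 v2 v3 v4] _] trs vrs Lw Lix B0 Bw hL hB hb.
have m s r i x : has (fun r' => code r == code r') [:: t; va; Idx; Stop; Carry; Digit] ->
    same rs' s0 s -> same rs' s0 (upd s r i x).
  move=> hr; apply: same_upd; rewrite /rs' -[_ :: _]/([:: t; va; Idx; Stop; Carry; Digit] ++ rs).
  by rewrite has_cat hr.
have mt s i x : same rs' s0 s -> same rs' s0 (upd s t i x) by apply: m; rewrite /= eqxx.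
have mv s i x : same rs' s0 s -> same rs' s0 (upd s va i x) by apply: m; rewrite /= eqxx orbT.
have mI s i x : same rs' s0 s -> same rs' s0 (upd s Idx i x) by apply: m; rewrite /= !orbT.
have mS s i x : same rs' s0 s -> same rs' s0 (upd s Stop i x) by apply: m; rewrite /= !orbT.
have mC s i x : same rs' s0 s -> same rs' s0 (upd s Carry i x) by apply: m; rewrite /= !orbT.
have mD s i x : same rs' s0 s -> same rs' s0 (upd s Digit i x) by apply: m; rewrite /= !orbT.
apply: wp_seq; apply: (wp_put ix_space) => /=; [lia|lia|].
apply: wp_seq; apply: (wp_for ix_space (N := L)
  (I := fun i s => [/\ same rs' s0 s, s t 0 = 0 & forall j, j < i -> s va j = 0])) => //.
- split=> //; first by apply: mI; apply: mt.
  by rewrite !updE (negbTE t2) /= !eqxx.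
- by move=> i s [sa _ _]; apply: hL.
- move=> i s iL [sa st sv] vi; apply: (wp_put ix_space) => /=; rewrite ?vi; [lia|lia|].
  split=> //; first by rewrite updE eq_sym (negbTE v1) /=.
  split; first by apply: mI; apply: mv.
    by rewrite !updE (negbTE t2) (negbTE t1) /=.
  move=> j; rewrite ltnS leq_eqVlt !updE (negbTE v1) /= eqxx /=; case: eqP => //= _; exact: sv.
move=> s [sa st sv] _; apply: wp_seq; apply: (wp_put ix_space) => /=; [lia|lia|].
pose Inv i s := [/\ same rs' s0 s, s t 0 = has P (map (digits B L) (iota 0 i)) &
  forall j, j < L -> s va j = i %/ B ^ j %% B].
set c := While _ _.
(* [d] is the number of vectors not yet tried, positive as long as [Stop] is 0. *)
suff main d i s1 : B ^ L = d + i -> 0 < d -> Inv i s1 -> s1 Stop 0 = 0 -> 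
    wp c (fun s' ts' => [/\ ts' = ts, same rs' s0 s' & s' t 0 = has P (vectors B L)]) s1 ts.
  apply: (main (B ^ L) 0); rewrite ?addn0 ?expn_gt0 ?B0 //.
  split; first exact: mS.
    by rewrite updE (negbTE t3) /=.
  by move=> j jL; rewrite updE (negbTE v2) /= sv // div0n mod0n.
clear s sa st sv; elim: d i s1 => // d IH i s eBL _ [sa st sv] stop0.
apply: (wp_while (e := (!Stop =? #0)%X)); rewrite [ev _ _]/= stop0 // -/c => _.
have eP : has P (map (digits B L) (iota 0 i.+1)) =
    has P (map (digits B L) (iota 0 i)) || P (digits B L i).
  by rewrite -addn1 iotaD map_cat has_cat /= orbF.
apply: wp_seq; apply: wp_conseq (hb s (digits B L i) ts _ _ sa _); rewrite ?size_mkseq //; last 2 first.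
- by apply/allP => x /mapP[j _ ->] /=; rewrite ltn_mod.
- by move=> j jL; rewrite nth_mkseq // sv.
move=> s1 _ [-> sb eb].
have sa1 : same rs' s0 s1.
  apply: same_trans sa _; apply: same_sub sb => r h.
  by rewrite /rs' /= h !orbT.
have sv1 j : j < L -> s1 va j = i %/ B ^ j %% B by move=> jL; rewrite sb // sv.
pose Inv1 s := [/\ same rs' s0 s, s t 0 = has P (map (digits B L) (iota 0 i.+1)) &
  forall j, j < L -> s va j = i %/ B ^ j %% B].
apply: wp_seq.
suff main s2 : Inv1 s2 -> wp (SetR Carry #1 ;;
    For Idx len (
      SetR Digit (va.[!Idx] + !Carry) ;; Put va !Idx (!Digit %% base) ;;
      SetR Carry (!Digit %/ base)) ;;
    SetR Stop !Carry) (wp c (fun s' ts' => [/\ ts' = ts, same rs' s0 s' &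
      s' t 0 = has P (vectors B L)])) s2 ts.
  apply: wp_if => /= h.
    apply: (wp_put ix_space) => /=; [lia|lia|]; apply: main; split; first exact: mt.
      by rewrite eP updE !eqxx /=; move: h; rewrite eb; case: (P _); rewrite ?orbT.
    by move=> j jL; rewrite updE eq_sym (negbTE t1) /= sv1.
  apply: wp_skip; apply: main; split=> //.
  by rewrite eP sb // st; move: h; rewrite eb; case: (P _); rewrite ?orbF.
clear s1 sb eb sa1 sv1 s sa st sv stop0.
move=> [sa st sv].
apply: wp_seq; apply: (wp_put ix_space) => /=; [lia|lia|].
(* During the increment the digits below [d] already belong to [i.+1], the others still to [i]. *)
apply: wp_seq; apply: (wp_for ix_space (N := L)
  (I := fun d s => [/\ same rs' s0 s, s t 0 = has P (map (digits B L) (iota 0 i.+1)),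
    s Carry 0 = (B ^ d %| i.+1) &
    forall j, j < L -> s va j = (if j < d then i.+1 else i) %/ B ^ j %% B])) => //.
- split; first by apply: mI; apply: mC.
  + by rewrite !updE (negbTE t2) (negbTE t4) /=.
  + by rewrite !updE /= expn0 dvd1n.
  + by move=> j jL; rewrite !updE (negbTE v1) (negbTE v3) /= sv.
- by move=> d' s [s'a _ _ _]; apply: hL.
- move=> x s xL [s1 s3 s4 s5] xi.
  have [c1 c2] := carry_step x i B0.
  have bx : i %/ B ^ x %% B + (B ^ x %| i.+1) <= B.
    apply: leq_trans (ltn_pmod (i %/ B ^ x) B0).
    by rewrite -(addn1 (_ %% _)) leq_add2l leq_b1.
  have e1 : s va (s Idx 0) + s Carry 0 = i %/ B ^ x %% B + (B ^ x %| i.+1).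
    by rewrite xi s4 s5 // ltnn.
  apply: wp_seq; apply: (wp_put ix_space) => /=; rewrite ?e1 //.
    exact: leq_ltn_trans bx Bw.
  apply: wp_seq; apply: (wp_put ix_space) => /=; rewrite !updE /= ?xi ?hB ?c1; try exact: mD.
  + exact: leq_trans xL Lix.
  + by apply: leq_ltn_trans Bw; rewrite ltnW // ltn_mod.
  have eb s' : same rs' s0 s' -> s' Digit 0 = i %/ B ^ x %% B + (B ^ x %| i.+1) ->
      ev s' (!Digit %/ base)%X = (B ^ x.+1 %| i.+1).
    by move=> sa' sd /=; rewrite hB // sd c2.
  have v4' : code Digit == code va = false by rewrite eq_sym; apply/negbTE.
  have v3' : code Carry == code va = false by rewrite eq_sym; apply/negbTE.
  have v1' : code Idx == code va = false by rewrite eq_sym; apply/negbTE.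
  apply: (wp_put ix_space); rewrite ?eb ?updE ?v4' //=; try (by do 2?[apply: mv|apply: mD]).
    by case: (_ %| _) => //; apply: leq_trans word_gt2.
  split=> //; first by rewrite v1'.
  split.
  + by apply: mI; apply: mC; apply: mv; apply: mD.
  + by rewrite (negbTE t2) (negbTE t4) (negbTE t1) (negbTE t5) /=.
  + by [].
  + move=> j jL; rewrite !updE (negbTE v1) (negbTE v3) (negbTE v4) eqxx /= ltnS leq_eqVlt.
    by case: (eqVneq j x) => [->|_] /=; [|rewrite s5].
move=> s [s1 s3 s4 s5] _.
apply: (wp_put ix_space) => /=; [by []|by rewrite s4; case: (_ %| _) => //; apply: leq_trans word_gt2|].
rewrite s4; have iv : Inv i.+1 (upd s Stop 0 (B ^ L %| i.+1)).
  split; first exact: mS.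
    by rewrite updE (negbTE t3) /=.
  by move=> j jL; rewrite updE (negbTE v2) /= s5 // jL.
(* [i.+1] is at most [B ^ L], so the carry out of the top digit occurs exactly when all vectors have
   been tried. *)
case: (posnP d) => [d0|d0].
  have e1 : i.+1 = B ^ L by rewrite eBL d0.
  apply: (wp_while (e := (!Stop =? #0)%X)); rewrite [ev _ _]/= updE /= e1 dvdnn //= => _; split=> //.
    exact: mS.
  by rewrite updE (negbTE t3) /= s3 e1.
have e1 : (B ^ L %| i.+1) = false by apply/negbTE/negP => /dvdn_leq; lia.
rewrite e1; apply: (IH i.+1) => //; first by rewrite eBL addSnnS.
by rewrite -e1.
Qed.
End Search.

(** * The search phase *)

(** Sums and products act as disjunction and conjunction. Adding 1 turns the plain vertices of the
    vectors into the shifted values held in the slots. *)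
Definition xlink (u v : xp) : xp :=
  ((Mid.[!Idx] =? v + #1) * ((EndA.[!Idx] =? u + #1) + (EndB.[!Idx] =? u + #1)) +
   (Mid.[!Idx] =? u + #1) * ((EndA.[!Idx] =? v + #1) + (EndB.[!Idx] =? v + #1)))%X.

Definition bad_position : cmd :=
  any_loop TAdj Idx xJ
    (SetR Aux ((xlink VecC.[!Pos] VecC.[(!Pos + #1) %% !Len] =? #0) =? #0)) Aux ;;
  any_loop TDel Idx xk (SetR Aux (VecX.[!Idx] =? VecC.[!Pos])) Aux ;;
  any_loop TDup Idx !Len
    (SetR Aux ((VecC.[!Idx] =? VecC.[!Pos]) * ((!Idx =? !Pos) =? #0))) Aux ;;
  SetR Aux ((!TAdj * ((!TDel + !TDup) =? #0)) =? #0).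

Definition good_cycle : cmd :=
  any_loop TBad Pos !Len bad_position Aux ;; SetR Aux (!TBad =? #0).

Definition cycle_of_length (lenok : xp) : cmd :=
  any_vec TCyc VecC !Len (XN + #1) good_cycle Aux ;;
  SetR Aux (!TCyc * ((lenok =? #0) =? #0)).

Definition good_deletion (lenok : xp) : cmd :=
  any_loop TLen Len (xM + #1) (cycle_of_length lenok) Aux ;; SetR Aux (!TLen =? #0).

(** Looks for an [X] such that no length and no vertex sequence give a cycle avoiding it. The
    outcome is stored negated, so that untouched memory means acceptance. *)
Definition search (lenok : xp) : cmd :=
  any_vec TSol VecX xk (XN + #1) (good_deletion lenok) Aux ;; SetR Rej (!TSol =? #0).

(** Adjacency in the recorded graph, taken on numbers so that arbitrary digits of a vector can be
    tested. *)
Definition link J (s : state) (u v : nat) := has (fun j =>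
  ((s Mid j == v.+1) && ((s EndA j == u.+1) || (s EndB j == u.+1))) ||
  ((s Mid j == u.+1) && ((s EndA j == v.+1) || (s EndB j == v.+1)))) (iota 0 J).

Definition good_at J s q (x c : nat -> nat) L i :=
  link J s (c i) (c (i.+1 %% L)) &&
  ~~ (has (fun j => x j == c i) (iota 0 q) || has (fun j => (c j == c i) && (j != i)) (iota 0 L)).

(** Transfers the test between a memory array and the enumerated vector, which agree only on the
    first [q] or [L] entries. *)
Lemma good_at_ext J s q x c x' c' L i : i < L ->
  (forall j, j < q -> x' j = x j) -> (forall j, j < L -> c' j = c j) ->
  good_at J s q x' c' L i = good_at J s q x c L i.
Proof.
move=> iL hx hc; rewrite /good_at !hc ?ltn_mod //; last exact: leq_ltn_trans iL.
congr (_ && ~~ (_ || _)); apply: eq_in_has => j; rewrite mem_iota /= add0n => jq.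
  by rewrite hx.
by rewrite hc.
Qed.

Lemma same_fun rs s s' r : same rs s s' ->
  ~~ has (fun r' => code r == code r') rs -> s' r = s r.
Proof. by move=> h hr; apply: functional_extensionality => i; apply: h. Qed.

(** * Verification of the nested search *)

Section Decide.
Variables (n k K space word ix : nat).
Hypothesis ix_space : 32 * ix <= space.
Hypothesis K_gt0 : 0 < cap n K.
Hypothesis k_K : cap n k <= cap n K.
Hypothesis n_gt1 : 1 < n.
Hypothesis J_ix : num_slots n K < ix.
Hypothesis nJ_word : n + num_slots n K + 2 < word.

Notation ev := (ev n k K).
Notation wp := (wp n k K space word).
Notation J := (num_slots n K).
Notation M := (max_matched n K).
Notation q := (cap n k).

Definition rs_pos := [:: TAdj; TDel; TDup; Idx; Aux].
Definition rs_cyc := [:: TBad, Pos & rs_pos].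
Definition rs_len := [:: TCyc, VecC, Idx, Stop, Carry, Digit & rs_cyc].
Definition rs_del := [:: TLen, Len & rs_len].

Lemma J_word : J < word. Proof. by move: nJ_word; lia. Qed.
Lemma M_J : M <= J.
Proof. apply: leq_trans (M_MM _) (MM_J _ _); exact: K_gt0. Qed.
Lemma ix_gt0 : 0 < ix. Proof. exact: leq_ltn_trans J_ix. Qed.
Lemma word_gt2 : 2 < word. Proof. by move: nJ_word; lia. Qed.
Lemma q_le : q <= M. Proof. by rewrite (leq_trans k_K) // /max_matched mul2n -addnn leq_addl. Qed.

Lemma wp_bad_position s ts : s Len 0 <= M ->
  wp bad_position (fun s' ts' => [/\ ts' = ts, same rs_pos s s' &
    s' Aux 0 = ~~ good_at J s q (s VecX) (s VecC) (s Len 0) (s Pos 0)]) s ts.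
Proof.
move=> LM; have i0 := ix_gt0; have w2 := word_gt2; have MJ := M_J; have Jw := J_word.
have sub t (s1 s2 : state) : has (fun r' => code t == code r') rs_pos ->
    same [:: t; Idx; Aux] s1 s2 -> same rs_pos s1 s2.
  move=> ht; apply: same_sub => r /= /or4P[/eqP -> //|/eqP ->|/eqP ->|//]; by rewrite ?orbT.
have aux (b : bool) : b < word by apply: leq_ltn_trans w2; case: b.
pose lk (s : state) (j u v : nat) := ((s Mid j == v.+1) && ((s EndA j == u.+1) || (s EndB j == u.+1))) ||
  ((s Mid j == u.+1) && ((s EndA j == v.+1) || (s EndB j == v.+1))).
apply: wp_seq; apply: (wp_then (wp_any (N := J) (rs := [:: Aux]) (P := fun j => lk s j (s VecC (s Pos 0))
     (s VecC ((s Pos 0).+1 %% s Len 0))) ix_space i0 w2 _ _ _ _ Jw _ _)) => //.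
  move=> s1 i ts1 iJ sa ei; apply: (wp_put ix_space) => //=; try exact: aux.
  split=> //; first exact: same_upd.
  rewrite updE /= ei !addn1 !sa //= /lk.
  by do 2!case: (s Mid i == _); do 2!case: (s EndA i == _); do 2!case: (s EndB i == _).
move=> s1 _ [-> sa ea].
apply: wp_seq; apply: (wp_then (wp_any (N := q) (rs := [:: Aux]) (P := fun j => s VecX j == s VecC (s Pos 0))
    ix_space i0 w2 _ _ _ _ _ _ _)) => //; first exact: leq_ltn_trans q_le (leq_ltn_trans MJ Jw).
  move=> s2 i ts1 iJ sb ei; apply: (wp_put ix_space) => //=; try exact: aux.
  split=> //; first exact: same_upd.
  by rewrite updE /= ei !sb // !sa.
move=> s2 _ [-> sb eb].
apply: wp_seq; apply: (wp_then (wp_any (N := s Len 0) (rs := [:: Aux]) (P := fun j => (s VecC j == s VecC (s Pos 0)) && (j != s Pos 0))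
    ix_space i0 w2 _ _ _ _ _ _ _)) => //; first exact: leq_ltn_trans LM (leq_ltn_trans MJ Jw).
- by move=> s3 sc /=; rewrite sc // sb // sa.
- move=> s3 i ts1 iJ sc ei; apply: (wp_put ix_space) => //=.
    by apply: leq_ltn_trans w2; case: (s3 VecC _ == _); case: (s3 Idx 0 == _).
  split=> //; first exact: same_upd.
  rewrite updE /= ei !sc // !sb // !sa //.
  by case: (s VecC i == _); case: (i == _).
move=> s3 _ [-> sc ec].
apply: (wp_put ix_space) => //=; try exact: aux.
split=> //.
  apply: same_upd => //; apply: same_trans (sub TAdj _ _ _ sa) _ => //.
  by apply: same_trans (sub TDel _ _ _ sb) _ => //; apply: sub sc.
rewrite updE /= sc // sb // ea ec sc // eb /good_at /link.
rewrite -/(lk _ _ _ _); case: (has _ _) => //=; case: (has _ _) => //=.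
by case: (has _ _).
Qed.

Lemma wp_good_cycle s ts : s Len 0 <= M ->
  wp good_cycle (fun s' ts' => [/\ ts' = ts, same rs_cyc s s' &
    s' Aux 0 = all (good_at J s q (s VecX) (s VecC) (s Len 0)) (iota 0 (s Len 0))]) s ts.
Proof.
move=> LM; have i0 := ix_gt0; have w2 := word_gt2; have MJ := M_J; have Jw := J_word.
have aux (b : bool) : b < word by apply: leq_ltn_trans w2; case: b.
apply: wp_seq; apply: (wp_then (wp_any (N := s Len 0) (rs := rs_pos) (P := predC (good_at J s q (s VecX) (s VecC) (s Len 0)))
    ix_space i0 w2 _ _ _ _ _ _ _)) => //; first exact: leq_ltn_trans LM (leq_ltn_trans MJ Jw).
- by move=> s1 sa /=; rewrite sa.
- move=> s1 i ts1 iL sa ei; apply: (wp_then (wp_bad_position _ _)) => //; first by rewrite sa.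
  move=> s2 _ [-> sb eb]; split=> //; rewrite eb /= ei /good_at /link.
  by rewrite !(same_fun sa).
move=> s1 _ [-> sa ea]; apply: (wp_put ix_space) => //=; try exact: aux.
split=> //; first exact: same_upd.
by rewrite updE /= ea has_predC; case: (all _ _).
Qed.

Section Length.
Variables (Lp : pred nat) (lenok : xp).
Hypothesis lenokP : forall s, (ev s lenok != 0) = (2 < s Len 0) && Lp (s Len 0).

Definition has_cycle s x L := has (fun c => all (good_at J s q x (nth 0 c) L) (iota 0 L))
  (vectors (n + 1) L).

Lemma wp_cycle_of_length s ts : s Len 0 <= M ->
  wp (cycle_of_length lenok) (fun s' ts' => [/\ ts' = ts, same rs_len s s' &
    s' Aux 0 = has_cycle s (s VecX) (s Len 0) && (2 < s Len 0) && Lp (s Len 0)]) s ts.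
Proof.
move=> LM; have i0 := ix_gt0; have w2 := word_gt2; have MJ := M_J; have Jw := J_word.
have aux (b : bool) : b < word by apply: leq_ltn_trans w2; case: b.
apply: wp_seq; apply: (wp_then (wp_any_vec (L := s Len 0) (B := n + 1) (rs := rs_cyc)
    (P := fun c => all (good_at J s q (s VecX) (nth 0 c) (s Len 0)) (iota 0 (s Len 0)))
    ix_space i0 w2 _ _ _ _ _ _ _ _ _ _ _)) => //.
- exact: leq_ltn_trans LM (leq_ltn_trans MJ Jw).
- exact: leq_trans (leq_trans LM MJ) (ltnW J_ix).
- by rewrite addn1.
- by move: nJ_word; lia.
- by move=> s1 sa /=; rewrite sa.
- move=> s1 w ts1 sw bw sa ew; apply: (wp_then (wp_good_cycle _ _)) => //; first by rewrite sa.
  move=> s2 _ [-> sb eb]; split=> //; rewrite eb (same_fun (r := Len) sa) //.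
  congr nat_of_bool; apply: eq_in_all => i; rewrite mem_iota /= add0n => iL.
  rewrite (@good_at_ext _ _ _ (s VecX) (nth 0 w)) //.
    by rewrite /good_at /link !(same_fun sa).
  by move=> j _; rewrite sa.
move=> s1 _ [-> sa ea]; apply: (wp_put ix_space) => //=; first by rewrite ea; apply: leq_ltn_trans w2; case: (has _ _); case: (ev _ _).
split=> //; first exact: same_upd.
rewrite updE /= ea -andbA; have := lenokP s1; rewrite sa // => <-.
by rewrite /has_cycle; case: (has _ _); case: (ev _ _).
Qed.

Definition good_del s x := ~~ has (fun L => has_cycle s x L && (2 < L) && Lp L) (iota 0 (M + 1)).

Lemma wp_good_deletion s ts :
  wp (good_deletion lenok) (fun s' ts' => [/\ ts' = ts, same rs_del s s' &
    s' Aux 0 = good_del s (s VecX)]) s ts.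
Proof.
have i0 := ix_gt0; have w2 := word_gt2; have MJ := M_J; have Jw := J_word.
have aux (b : bool) : b < word by apply: leq_ltn_trans w2; case: b.
apply: wp_seq; apply: (wp_then (wp_any (N := M + 1) (rs := rs_len) (P := fun L => has_cycle s (s VecX) L && (2 < L) && Lp L)
    ix_space i0 w2 _ _ _ _ _ _ _)) => //; first by move: nJ_word; lia.
- move=> s1 i ts1 iL sa ei; apply: (wp_then (wp_cycle_of_length _ _)) => //; first by rewrite ei; lia.
  move=> s2 _ [-> sb eb]; split=> //; rewrite eb /= ei /has_cycle /good_at /link.
  by rewrite !(same_fun sa).
move=> s1 _ [-> sa ea]; apply: (wp_put ix_space) => //=; try exact: aux.
split=> //; first exact: same_upd.
by rewrite updE /= ea /good_del; case: (has _ _).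
Qed.

Lemma has_cycle_ext s s' x x' L :
  (forall r, r = Mid \/ r = EndA \/ r = EndB -> s' r = s r) ->
  (forall j, j < q -> x' j = x j) -> has_cycle s' x' L = has_cycle s x L.
Proof.
move=> hs hx; rewrite /has_cycle; apply: eq_has => c; apply: eq_in_all => i.
rewrite mem_iota /= add0n => iL; rewrite (@good_at_ext _ _ _ x (nth 0 c)) //.
by rewrite /good_at /link !hs; auto.
Qed.

Lemma wp_search s ts :
  wp (search lenok) (fun s' ts' => s' Rej 0 =
    ~~ has (fun x => good_del s (nth 0 x)) (vectors (n + 1) q)) s ts.
Proof.
have i0 := ix_gt0; have w2 := word_gt2; have MJ := M_J; have Jw := J_word.
have aux (b : bool) : b < word by apply: leq_ltn_trans w2; case: b.
apply: wp_seq; apply: (wp_then (wp_any_vec (L := q) (B := n + 1) (rs := rs_del) (P := fun x => good_del s (nth 0 x))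
    ix_space i0 w2 _ _ _ _ _ _ _ _ _ _ _)) => //.
- exact: leq_ltn_trans q_le (leq_ltn_trans MJ Jw).
- exact: leq_trans (leq_trans q_le MJ) (ltnW J_ix).
- by rewrite addn1.
- by move: nJ_word; lia.
- move=> s1 w ts1 sw bw sa ew; apply: (wp_then (wp_good_deletion _)).
  move=> s2 _ [-> sb eb]; split=> //; rewrite eb /good_del; congr (nat_of_bool (~~ _)).
  apply: eq_has => L; rewrite (@has_cycle_ext s s1 (nth 0 w)) //.
  by move=> r [->|[->|->]]; apply: same_fun sa _.
move=> s1 _ [-> sa ea]; apply: (wp_put ix_space) => //=; try exact: aux.
by rewrite updE /= ea; case: (has _ _).
Qed.
End Length.
End Decide.

(** * Correctness *)

(** Positional form of [cycle], with wrap-around modulo the length, as tested by [good_at]. *)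
Lemma cycle_nth (T : Type) (e : rel T) x0 c :
  cycle e c <-> (forall i, i < size c -> e (nth x0 c i) (nth x0 c (i.+1 %% size c))).
Proof.
case: c => [|u p] //=.
have e1 i : i < (size p).+1 -> nth x0 (u :: rcons p u) i = nth x0 (u :: p) i.
  by case: i => //= i; rewrite ltnS nth_rcons => ->.
have e2 i : i < (size p).+1 -> nth x0 (rcons p u) i = nth x0 (u :: p) (i.+1 %% (size p).+1).
  rewrite ltnS leq_eqVlt nth_rcons => /orP[/eqP ->|ip]; first by rewrite ltnn eqxx modnn.
  by rewrite ip modn_small.
split=> [/(pathP x0) h i ip|h].
  by have := h i; rewrite size_rcons e1 // e2 //; apply.
by apply/(pathP x0) => i; rewrite size_rcons => ip; rewrite e1 // e2 //; apply: h.
Qed.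

Lemma ord_seq n (w : seq nat) : all (gtn n) w -> exists c : seq 'I_n, w = map val c.
Proof.
elim: w => [|x w IH] /=; first by exists [::].
by move=> /andP[xn /IH[c ->]]; exists (Ordinal xn :: c).
Qed.

Section Decoding.
Variables (n k K : nat) (G : sgraph 'I_n) (S : {set 'I_n}).
Hypothesis VC : vertex_cover G S.
Hypothesis SK : #|S| <= cap n K.
Hypothesis k_K : cap n k <= cap n K.
Hypothesis K_gt0 : 0 < cap n K.

Notation J := (num_slots n K).
Notation M := (max_matched n K).
Notation l := (pair_limit n K).
Notation q := (cap n k).

Variable s : state.
Let e' : rel 'I_n := fun u v => link J s u v.

Lemma link_sym : symmetric e'.
Proof. by move=> u v; rewrite /e' /link; apply: eq_has => j; rewrite orbC. Qed.

Lemma stored_link j (a b y : 'I_n) : j < J ->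
  stored s j (enc a) (enc b) (enc y) -> e' a y /\ e' b y.
Proof.
move=> jJ [ea eb ey]; split; apply/hasP; exists j; rewrite ?mem_iota ?add0n //;
  by rewrite ea eb ey !eqxx ?orbT.
Qed.

Lemma link_sound u v : sound G s -> link J s u v ->
  exists a b : 'I_n, [/\ u = a, v = b & adj G a b].
Proof.
move=> so /hasP[j _]; case: (so j) => [->//|[a [b [y [[-> -> ->] ay by_]]]]].
rewrite !eqSS => /orP[]/andP[/eqP <- /orP[/eqP <-|/eqP <-]];
  [exists a, y|exists b, y|exists y, a|exists y, b]; split=> //; by rewrite adj_sym.
Qed.

(** Once all vertices are finished, the invariants provide the hypotheses of rerouting: [so_edge]
    for edges inside [ms], [mo_closed] for vertices outside, and the quota in [pair_slots] for the
    paths. *)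
Lemma stored_hits dn ms (Lp : pred nat) (X : {set 'I_n}) :
  matching_ok G S dn ms s -> slots_ok K G dn ms s -> (forall v, v \in dn) ->
  #|X| <= q -> hits e' Lp (mem X) <-> hits (adj G) Lp (mem X).
Proof.
move=> mo so all_dn Xq; have sM := matching_size SK mo.
have sub u v : e' u v -> adj G u v.
  by move=> /(link_sound (so_sound so))[a [b [/val_inj -> /val_inj ->]]].
have pi a b : a \in ms -> b \in ms -> [/\ pair_index K ms a b < M * M,
    mat ms (pair_index K ms a b %/ M) = enc a & mat ms (pair_index K ms a b %% M) = enc b].
  by move=> am bm; have [h1 -> ->] := pair_index_lt K_gt0 sM am bm; rewrite !mat_index.
apply: (@hits_reroute _ G e' (mem ms) Lp S X l) => //; first exact: link_sym.
- move=> u v um vm uv; case: (so_edge so um vm (all_dn _) (all_dn _) uv).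
    have [h1 h2 h3] := pi u v um vm; rewrite /edge_slot h2 h3.
    by move=> /stored_link[]; first exact: slot_lt.
  have [h1 h2 h3] := pi v u vm um; rewrite /edge_slot h2 h3.
  by move=> /stored_link[]; [exact: slot_lt|rewrite link_sym].
- by move=> y x; exact: (mo_closed mo (all_dn y)).
- move=> y a b ym ya yb.
  have am := mo_closed mo (all_dn y) ym ya; have bm := mo_closed mo (all_dn y) ym yb.
  have [h1 h2 h3] := pi a b am bm.
  have [ys [[uys _ ysl] _ st full]] := so_pair so h1.
  have ys_link z : z \in ys -> e' a z /\ e' b z.
    move=> zys; have := st (index z ys); rewrite index_mem => /(_ zys)[_ _].
    rewrite h2 h3 (nth_map z) ?index_mem // nth_index //; apply: stored_link.
    by apply: slot_lt => //; apply: leq_trans ysl; rewrite ltnW // index_mem.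
  case: (ltnP (size ys) l) => sl; last by right; exists ys.
  by left; apply: ys_link; apply: (full y a b).
(* [#|X| + 2 * #|S|] is at most [3 * cap n K], one below the quota. *)
- by rewrite /pair_limit; lia.
Qed.

(** Entries equal to [n] name no vertex, so vectors of a fixed length also encode the smaller
    sets. *)
Definition in_vector (x : seq nat) : {set 'I_n} := [set v : 'I_n | val v \in x].

Lemma has_cycleP x L : sound G s -> 0 < L -> size x = q ->
  has_cycle n k K s (nth 0 x) L <->
  exists c : seq 'I_n, [/\ size c = L, cycle e' c, uniq c & ~~ has (mem (in_vector x)) c].
Proof.
move=> so L0 sx.
have Xh v : (v \in x) = has (fun j => nth 0 x j == v) (iota 0 q).
  apply/idP/hasP => [vx|[j]]; last by rewrite mem_iota /= add0n -sx => jx /eqP <-; apply: mem_nth.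
  by exists (index v x); rewrite ?nth_index // mem_iota /= add0n -sx index_mem.
split.
  move=> /(hasP_vectors _ _ (ltn_addl _ (ltnSn 0)))[w [sw _ /allP gw]].
  have lw i : i < L -> link J s (nth 0 w i) (nth 0 w (i.+1 %% L)).
    by move=> iL; have := gw i; rewrite mem_iota add0n => /(_ iL) /andP[].
  (* Every entry is linked to its successor, so by soundness it is a vertex and not the extra digit
     [n]. *)
  have [c ec] : exists c : seq 'I_n, w = map val c.
    apply: ord_seq; apply/(all_nthP 0) => i; rewrite sw => /lw /(link_sound so)[a [b [-> _ _]]] /=.
    exact: ltn_ord.
  have sc : size c = L by rewrite -sw ec size_map.
  have x0 : 'I_n by case: (c) sc L0 => [|z c'] //= <-.
  have nc i : i < L -> nth 0 w i = nth x0 c i by move=> iL; rewrite ec (nth_map x0) ?sc.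
  exists c; split=> //.
  - apply/(cycle_nth _ x0) => i; rewrite sc => iL; rewrite /e' -!nc ?ltn_mod //.
    exact: lw.
  - apply/(uniqP x0) => i j; rewrite !inE sc => iL jL eij; apply/eqP.
    have := gw i; rewrite mem_iota add0n => /(_ iL) /andP[_]; rewrite negb_or => /andP[_].
    apply: contraNT => ne; apply/hasP; exists j; first by rewrite mem_iota add0n.
    by rewrite !nc // eij eqxx eq_sym.
  - apply/hasPn => v vc; change (v \notin in_vector x); rewrite inE Xh.
    have iL : index v c < L by rewrite -sc index_mem.
    have := gw (index v c); rewrite mem_iota add0n => /(_ iL) /andP[_]; rewrite negb_or => /andP[].
    by rewrite nc // nth_index.
move=> [c [sc cc uc Xc]]; apply/(hasP_vectors _ _ (ltn_addl _ (ltnSn 0))).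
have x0 : 'I_n by case: (c) sc L0 => [|z c'] //= <-.
exists (map val c); split; first by rewrite size_map.
  by apply/allP => z /mapP[v _ ->] /=; rewrite addn1 ltnS ltnW ?ltn_ord.
have nc i : i < L -> nth 0 (map val c) i = nth x0 c i by move=> iL; rewrite (nth_map x0) ?sc.
apply/allP => i; rewrite mem_iota /= add0n => iL.
rewrite /good_at !nc ?ltn_mod //; apply/andP; split.
  by move/(cycle_nth _ x0): cc => /(_ i); rewrite sc; apply.
rewrite negb_or -Xh; apply/andP; split.
  have /hasPn h := Xc; have {h} : nth x0 c i \notin in_vector x by apply: h; rewrite mem_nth ?sc.
  by rewrite inE.
apply/hasPn => j; rewrite mem_iota /= add0n => jL; rewrite nc //.
apply/negP => /andP[/eqP/val_inj/eqP]; rewrite nth_uniq ?sc // => /eqP ->.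
by rewrite eqxx.
Qed.

Lemma good_delP (Lp : pred nat) x : sound G s -> size x = q ->
  good_del n k K Lp s (nth 0 x) <-> hits e' Lp (mem (in_vector x)).
Proof.
move=> so sx; split.
  move=> /hasPn h c sc cc uc lc; apply: contraT => Xc.
  have cG : cycle (adj G) c.
    case: c cc {sc uc lc Xc} => //= u c; apply: sub_path => a b.
    by move=> /(link_sound so)[a' [b' [/val_inj -> /val_inj ->]]].
  (* As a cycle of [G], [c] is no longer than [2 * #|S|], so its length lies in the searched
     range. *)
  have := h (size c); rewrite mem_iota /= add0n addn1 ltnS.
  rewrite (leq_trans (cycle_size_cover VC cG uc)); last by rewrite leq_mul2l SK.
  move=> /(_ isT); rewrite sc lc !andbT => /negP[]; apply/has_cycleP => //.
    exact: leq_trans sc.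
  by exists c.
move=> h; apply/hasPn => L _; apply/negP => /andP[/andP[hc L2] lL].
have [c [sc cc uc Xc]] := (has_cycleP so (ltnW (ltnW L2)) sx).1 hc.
by have := h c; rewrite sc (negbTE Xc) => /(_ L2 cc uc lL).
Qed.

Lemma in_vector_card x : #|in_vector x| <= size x.
Proof.
rewrite cardE -(size_map val); apply: uniq_leq_size.
  by rewrite map_inj_uniq ?enum_uniq //; apply: val_inj.
by move=> z /mapP[v]; rewrite mem_enum inE => vx ->.
Qed.

Lemma in_vectorP (X : {set 'I_n}) : #|X| <= k ->
  exists x, [/\ size x = q, all (gtn (n + 1)) x & in_vector x = X].
Proof.
move=> Xk; have Xn : #|X| <= n by rewrite -[leqRHS]card_ord max_card.
have Xq : #|X| <= q by rewrite /cap; lia.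
exists (map val (enum X) ++ nseq (q - #|X|) n); split.
- by rewrite size_cat size_map size_nseq -cardE subnKC.
- rewrite all_cat all_nseq /= addn1 ltnSn orbT andbT.
  by apply/allP => z /mapP[v _ ->] /=; rewrite ltnS ltnW ?ltn_ord.
- apply/setP => v; rewrite inE mem_cat mem_nseq mem_map ?mem_enum; last exact: val_inj.
  by rewrite (ltn_eqF (ltn_ord v)) andbF orbF.
Qed.

Lemma search_correct dn ms (Lp : pred nat) :
  matching_ok G S dn ms s -> slots_ok K G dn ms s -> (forall v, v \in dn) ->
  has (fun x => good_del n k K Lp s (nth 0 x)) (vectors (n + 1) q) <->
  deletion_problem (no_cycle Lp) G k.
Proof.
move=> mo so all_dn; have ss := so_sound so; split.
  move=> /(hasP_vectors _ _ (ltn_addl _ (ltnSn 0)))[x [sx _ gx]].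
  have Xq : #|in_vector x| <= q by rewrite -sx; exact: in_vector_card.
  exists (in_vector x); split; first by rewrite (leq_trans Xq) // /cap; lia.
  by apply/deletion_no_cycle; apply/(stored_hits _ mo so all_dn Xq); apply/good_delP.
move=> [X [Xk hX]]; apply/(hasP_vectors _ _ (ltn_addl _ (ltnSn 0))).
have [x [sx bx eX]] := in_vectorP Xk; exists x; split=> //.
apply/good_delP => //; rewrite eX; apply/(stored_hits _ mo so all_dn).
  by rewrite -eX -sx; exact: in_vector_card.
exact/deletion_no_cycle.
Qed.
End Decoding.

(** * The algorithm and its resource bounds *)

Definition main (lenok : xp) : algorithm := {|
  body := IfX (xM <? #3)%X Skip (read_stream ;; search lenok);
  answer := cp (!Rej =? #0)%X |}.

Lemma view_nil : view [::] = fun _ _ => 0.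
Proof.
by apply: functional_extensionality => r; apply: functional_extensionality => i; rewrite /view nth_nil.
Qed.

(** Such a cover leaves no room for a cycle, so [X] may be empty. The program answers this case
    without using memory, as the bounds below assume [2 <= cap n K]. *)
Lemma small_cover_no_cycle (Lp : pred nat) n k (G : sgraph 'I_n) (S : {set 'I_n}) :
  vertex_cover G S -> 2 * #|S| < 3 -> deletion_problem (no_cycle Lp) G k.
Proof.
move=> VC S3; exists set0; rewrite cards0; split=> //; apply/deletion_no_cycle.
by move=> c sc cc uc _; have := cycle_size_cover VC cc uc; lia.
Qed.

(** With [c = cap n K] there are [12 * c ^ 3 + 8 * c ^ 2] slots, and [2 <= c] absorbs the
    lower-order terms. *)
Lemma space_bound n K : 2 <= cap n K -> 32 * (num_slots n K).+1 <= 640 * K ^ 3.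
Proof.
move=> c2; have cK : cap n K <= K by rewrite /cap; lia.
apply: (@leq_trans (640 * cap n K ^ 3)); last by rewrite leq_mul2l leq_exp2r.
rewrite /num_slots /max_matched /pair_limit; move: c2; move: (cap n K) => c c2; rewrite !expnS expn0 muln1.
nia.
Qed.

(** The left side is at most [18 * n ^ 3], and [18 < 2 ^ 5 <= n ^ 5], so already [8 * up_log 2 n]
    bits suffice; 640 is the constant of the space bound. *)
Lemma word_bound n K : 2 <= cap n K -> n + num_slots n K + 2 < 2 ^ (640 * up_log 2 n).
Proof.
move=> c2; have cn : cap n K <= n by rewrite /cap; lia.
apply: (@leq_ltn_trans (18 * n ^ 3)).
  rewrite /num_slots /max_matched /pair_limit; move: c2 cn; move: (cap n K) => c c2 cn; rewrite !expnS expn0 muln1.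
  have h1 : c * c <= n * n by apply: leq_mul.
  have h2 : c * (c * c) <= n * (n * n) by apply: leq_mul.
  nia.
have n2 : 2 <= n by apply: leq_trans cn.
apply: (@leq_trans (n ^ 8)).
  have -> : n ^ 8 = n ^ 5 * n ^ 3 by rewrite -expnD.
  rewrite ltn_mul2r expn_gt0 (leq_trans _ n2) //=.
  by apply: (@leq_trans (2 ^ 5)) => //; rewrite leq_exp2r.
apply: (@leq_trans ((2 ^ up_log 2 n) ^ 8)); first by rewrite leq_exp2r // up_logP.
by rewrite -expnM leq_exp2l // mulnC leq_mul2r orbT.
Qed.

Lemma no_cycle_streamable (Lp : pred nat) (lenok : xp) :
  (forall n k K s, (ev n k K s lenok != 0) = (2 < s Len 0) && Lp (s Len 0)) ->
  AL_streamable (deletion_problem (no_cycle Lp)) (fun K => K ^ 3).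
Proof.
move=> lenokP; exists (main lenok), 640 => n k K G ts kK [S [VC SK]] [vs [nb [pvs pnb ->]]].
have SK' : #|S| <= cap n K.
  have Sn : #|S| <= n by rewrite -[leqRHS]card_ord max_card.
  by rewrite /cap; lia.
have kK' : cap n k <= cap n K by rewrite /cap; lia.
set space := (640 * _); set word := (2 ^ _).
set st := flatten _.
suff w : wp n k K space word (body (main lenok))
    (fun s' _ => s' Rej 0 = 0 <-> deletion_problem (no_cycle Lp) G k) (fun _ _ => 0) st.
  have [m' [ts' [e h]]] := w [::] view_nil; exists m', ts'; split=> //.
  rewrite eval_cp /=; rewrite -h; case: (view m' Rej 0) => //=.
apply: wp_if => [h|h].
  apply: wp_skip; split=> // _; apply: small_cover_no_cycle VC _.
  by move: h; rewrite /= -/(cap n K); case: ltnP => // h _; apply: leq_ltn_trans h; rewrite leq_mul2l SK'.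
have c2 : 2 <= cap n K.
  by move: h; rewrite /= -/(cap n K); case: ltnP => // h _; lia.
have ixs := space_bound c2; have wdb := word_bound c2.
have K0 : 0 < cap n K by apply: ltnW.
have n1 : 1 < n by apply: leq_trans c2 _; rewrite /cap; lia.
apply: wp_seq.
apply: (wp_read_stream (K := K) (ix := (num_slots n K).+1) ixs K0 (ltnSn _) wdb VC SK' (nb := nb) (dn := [::])) => //.
- by move=> v u; rewrite (perm_mem (pnb v)) mem_enum inE.
- by rewrite (perm_uniq pvs) enum_uniq.
(* Initially nothing is finished or matched and all cells are 0; [Cur] being 0, [flush] does
   nothing. *)
- split=> // v ts'; apply: wp_if => // _; apply: wp_skip; split=> //; exists [::].
  split; split=> //.
  + by move=> p; rewrite /mat /= nth_nil.
  + by left.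
  + by move=> t _; exists [::]; split.
move=> s' dn' [ms [mo so]] sub_dn.
apply: wp_conseq (wp_search (s := s') ixs K0 kK' n1 (ltnSn _) wdb (lenokP n k K) _) => s2 ts2 ->.
rewrite -(search_correct VC SK' kK' K0 Lp mo so); last first.
  by move=> v; apply: sub_dn; rewrite mem_cat (perm_mem pvs) mem_enum.
by case: (has _ _).
Qed.

Lemma AL_streamable_iff (P1 P2 : graph_class) f :
  (forall T (G : sgraph T), P1 T G <-> P2 T G) ->
  AL_streamable (deletion_problem P2) f -> AL_streamable (deletion_problem P1) f.
Proof.
move=> h [A [C hA]]; exists A, C => n k K G ts kK VC st.
have [m [ts' [e ans]]] := hA n k K G ts kK VC st; exists m, ts'; split=> //.
by rewrite ans; symmetry; apply: deletion_problem_iff.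
Qed.

Theorem corollary4p5 :
  [/\ AL_streamable FeedbackVertexSet (fun K => K ^ 3),
      AL_streamable EvenCycleTransversal (fun K => K ^ 3),
      AL_streamable OddCycleTransversal (fun K => K ^ 3)
    & AL_streamable TriangleDeletion (fun K => K ^ 3)].
Proof.
split.
- apply: AL_streamable_iff (@acyclic_no_cycle) _.
  (* The length test carries the condition [2 < L], since the search also tries shorter vectors. *)
  apply: (@no_cycle_streamable _ (#2 <? !Len)%X) => n k K s /=.
  by rewrite andbT; case: ltnP.
- apply: (@AL_streamable_iff _ (no_cycle (fun L => ~~ odd L))).
    by move=> T G; split=> h c /h; rewrite negbK.
  apply: (@no_cycle_streamable _ ((#2 <? !Len) * ((!Len %% #2) =? #0))%X) => n k K s /=.
  by rewrite modn2; case: ltnP; case: odd.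
(* [odd_cycle_free] unfolds to [no_cycle odd], so the lemma applies directly. *)
- apply: (@no_cycle_streamable odd ((#2 <? !Len) * (!Len %% #2))%X) => n k K s /=.
  by rewrite modn2; case: ltnP; case: odd.
- apply: AL_streamable_iff (@triangle_no_cycle) _.
  apply: (@no_cycle_streamable _ (!Len =? #3)%X) => n k K s /=.
  by case: (eqVneq (s Len 0) 3) => [->|_]; rewrite ?andbF.
Qed.
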